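(* Let $\mathcal{H}$ be a real Hilbert space, let $z\in\mathcal{H}$, let $m$ be a strictly positive integer, let $f\in\Gamma_0(\mathcal{H})$, and let $h:\mathcal{H}\to\mathbb{R}$ be convex and differentiable with a $v_0$-Lipschitzian gradient for some $v_0\in(0,+\infty)$. For every $i\in\{1,\dots,m\}$, let $\mathcal{G}_i$ be a real Hilbert space, let $r_i\in\mathcal{G}_i$, let $g_i\in\Gamma_0(\mathcal{G}_i)$, and let $L_i:\mathcal{H}\to\mathcal{G}_i$ be a nonzero bounded linear operator. Consider the problem $$\text{(P)}\quad\underset{x\in\mathcal{H}}{\text{minimize}}\ f(x)+\sum_{i=1}^mg_i(L_ix-r_i)+h(x)-\langle x,z\rangle$$ and the dual problem $$\text{(D)}\quad\underset{v_1\in\mathcal{G}_1,\dots,v_m\in\mathcal{G}_m}{\text{minimize}}\ (f^*\Box h^* )\Big(z-\sum_{i=1}^mL_i^*v_i\Big)+\sum_{i=1}^m\big(g_i^*(v_i)+\langle v_i,r_i\rangle\big).$$ Suppose that $$z\in\operatorname{ran}\Big(\partial f+\sum_{i=1}^mL_i^*(\partial g_i)(L_i\cdot-r_i)+\nabla h\Big).$$ Let $\alpha\in(0,+\infty)$, let $(\eta_{0,n})_{n\in\mathbb{N}}$ be a sequence in $\ell^1_+(\mathbb{N})$, let $(U_n)_{n\in\mathbb{N}}$ be a sequence in $\mathcal{P}_\alpha(\mathcal{H})$, and for every $i\in\{1,\dots,m\}$ let $(\eta_{i,n})_{n\in\mathbb{N}}$ be a sequence in $\ell^1_+(\mathbb{N})$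 and $(U_{i,n})_{n\in\mathbb{N}}$ a sequence in $\mathcal{P}_\alpha(\mathcal{G}_i)$, such that $\mu=\sup_{n\in\mathbb{N}}\{\|U_n\|,\|U_{1,n}\|,\dots,\|U_{m,n}\|\}<+\infty$ and, for every $n\in\mathbb{N}$, $$(1+\eta_{0,n})U_{n+1}\succcurlyeq U_n\quad\text{and}\quad(\forall i\in\{1,\dots,m\})\ (1+\eta_{i,n})U_{i,n+1}\succcurlyeq U_{i,n}.$$ Let $(a_{1,n})_{n\in\mathbb{N}},(b_{1,n})_{n\in\mathbb{N}},(c_{1,n})_{n\in\mathbb{N}}$ be absolutely summable sequences in $\mathcal{H}$ and, for every $i\in\{1,\dots,m\}$, let $(a_{2,i,n})_{n\in\mathbb{N}},(b_{2,i,n})_{n\in\mathbb{N}},(c_{2,i,n})_{n\in\mathbb{N}}$ be absolutely summable sequences in $\mathcal{G}_i$. Set $$\beta=v_0+\sqrt{\sum_{i=1}^m\|L_i\|^2},$$ let $x_0,p_{1,-1}\in\mathcal{H}$, let $(v_{1,0},\dots,v_{m,0})$ and $(p_{2,1,-1},\dots,p_{2,m,-1})$ be in $\mathcal{G}_1\oplus\dots\oplus\mathcal{G}_m$, let $\lambda<\frac{1}{\sqrt{10}\,\mu\beta}$ and let $(\gamma_n)_{n\in\mathbb{N}}$ be a sequence in $(0,\lambda]$ with $\liminf_{n\to+\infty}\gamma_n>0$. For every $n\in\mathbb{N}$ set $$\begin{aligned} &y_{1,n}=x_n-\gamma_nU_n\Big(\nabla h(p_{1,n-1})+\sum_{i=1}^mL_i^*(p_{2,i,n-1})+a_{1,n}\Big),\\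 &\text{for } i=1,\dots,m:\ \begin{cases}y_{2,i,n}=v_{i,n}+\gamma_nU_{i,n}\big(L_i(p_{1,n-1})+a_{2,i,n}\big),\\ p_{2,i,n}=\operatorname{prox}_{\gamma_ng_i^*}^{U_{i,n}^{-1}}(y_{2,i,n}-\gamma_nU_{i,n}r_i)+b_{2,i,n},\end{cases}\\ &p_{1,n}=\operatorname{prox}_{\gamma_nf}^{U_n^{-1}}(y_{1,n}+\gamma_nU_nz)+b_{1,n},\\ &\text{for } i=1,\dots,m:\ \begin{cases}q_{2,i,n}=p_{2,i,n}+\gamma_nU_{i,n}\big(L_i(p_{1,n})+c_{2,i,n}\big),\\ v_{i,n+1}=v_{i,n}-y_{2,i,n}+q_{2,i,n},\end{cases}\\ &q_{1,n}=p_{1,n}-\gamma_nU_n\Big(\nabla h(p_{1,n})+\sum_{i=1}^mL_i^*(p_{2,i,n})+c_{1,n}\Big),\\ &x_{n+1}=x_n-y_{1,n}+q_{1,n}. \end{aligned}$$ Then the following hold. (i) $\sum_{n\in\mathbb{N}}\|x_n-p_{1,n}\|^2<+\infty$ and, for every $i\in\{1,\dots,m\}$, $\sum_{n\in\mathbb{N}}\|v_{i,n}-p_{2,i,n}\|^2<+\infty$. (ii) There exist a solution $\bar{x}$ to (P) and a solution $(\bar{v}_1,\dots,\bar{v}_m)$ to (D) such that: (a) $z-\sum_{j=1}^mL_j^*\bar{v}_j\in\partial f(\bar{x})+\nabla h(\bar{x})$ and, for every $i\in\{1,\dots,m\}$, $L_i\bar{x}-r_i\in\partial g_i^*(\bar{v}_i)$;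 (b) $x_n\rightharpoonup\bar{x}$ and $p_{1,n}\rightharpoonup\bar{x}$; (c) for every $i\in\{1,\dots,m\}$, $v_{i,n}\rightharpoonup\bar{v}_i$ and $p_{2,i,n}\rightharpoonup\bar{v}_i$.
   Context: $\mathbb{N}=\{0,1,2,\dots\}$. $\langle\cdot,\cdot\rangle$ and $\|\cdot\|$ denote scalar products and norms of the Hilbert spaces (and $\|\cdot\|$ also operator norms); $\rightharpoonup$ denotes weak convergence; $Id$ is the identity; $L^*$ is the adjoint of $L$; $\mathcal{G}_1\oplus\dots\oplus\mathcal{G}_m$ is the Hilbert direct sum. $\ell^1_+(\mathbb{N})$ is the set of summable sequences in $[0,+\infty)$; a sequence $(a_n)$ in a Hilbert space is absolutely summable if $\sum_n\|a_n\|<+\infty$. For self-adjoint bounded linear operators $U,V$ on a real Hilbert space $\mathcal{K}$, $U\succcurlyeq V$ means $\langle Ux,x\rangle\ge\langle Vx,x\rangle$ for all $x\in\mathcal{K}$; $\mathcal{P}_\alpha(\mathcal{K})$ is the set of self-adjoint bounded linear operators $U$ on $\mathcal{K}$ with $U\succcurlyeq\alpha\,Id$; and for $U\in\mathcal{P}_\alpha(\mathcal{K})$ with $\alpha>0$, $\|x\|_U=\sqrt{\langle Ux,x\rangle}$. $\Gamma_0(\mathcal{K})$ is the class of lower semicontinuous convex functions $f:\mathcal{K}\to(-\infty,+\infty]$ with $\{x:f(x)<+\infty\}\neq\emptyset$. The conjugate is $f^*(u)=\sup_{x\in\mathcal{K}}(\langle x,u\rangle-f(x))$; the infimal convolution is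 $(f\Box g)(x)=\inf_{y\in\mathcal{K}}(f(y)+g(x-y))$; the subdifferential is $\partial f(x)=\{u\in\mathcal{K}:(\forall y\in\mathcal{K})\ \langle y-x,u\rangle+f(x)\le f(y)\}$. The range of a set-valued operator $T$ is $\operatorname{ran}T=\{u:(\exists x)\ u\in Tx\}$. For $U\in\mathcal{P}_\alpha(\mathcal{K})$ with $\alpha>0$ and $f\in\Gamma_0(\mathcal{K})$, the proximity operator of $f$ relative to the metric induced by $U$ is $\operatorname{prox}_f^U(x)=\operatorname{argmin}_{y\in\mathcal{K}}\big(f(y)+\tfrac12\|x-y\|_U^2\big)$. *)

(* Defs.v *)
From HB Require Import structures.
From mathcomp Require Import all_boot all_order all_algebra.
From mathcomp Require Import sesquilinear.
From mathcomp Require Import all_classical all_reals all_analysis.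
Set Implicit Arguments.
Unset Strict Implicit.
Unset Printing Implicit Defensive.
Import Order.TTheory GRing.Theory Num.Theory.
Import numFieldNormedType.Exports.
Local Open Scope classical_set_scope.
Local Open Scope ring_scope.

HB.mixin Record isHilbert (R : realType) H of CompleteNormedModule R H := {
  inner : {dot H for idfun} ;
  innerE : forall x : H, inner x x = `|x| ^+ 2
}.

#[short(type="hilbertType")]
HB.structure Definition Hilbert (R : realType) :=
  {H of CompleteNormedModule R H & isHilbert R H}.

Notation "''[' x , y ]" := (inner x y) (at level 0) : ring_scope.

Section Operators.
Context {R : realType}.

Definition bounded_op {H G : hilbertType R} (L : {linear H -> G}) : Prop :=
  bounded_near L (nbhs (0 : H)).

(* Meaningful for bounded operators only, the set being unbounded otherwise. *)
Definition opnorm {H G : hilbertType R} (L : {linear H -> G}) : R :=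
  sup [set `|L x| | x in [set x : H | `|x| <= 1]].

(* The element selected by [xget] exists (Riesz) and is unique when [L] is
   bounded. *)
Definition adjoint {H G : hilbertType R} (L : {linear H -> G}) (v : G) : H :=
  xget 0 [set u : H | forall x, '[L x, v] = '[x, u]].

Definition loewner_ge {K : hilbertType R} (U V : K -> K) : Prop :=
  forall x, '[V x, x] <= '[U x, x].

Definition Pcal {K : hilbertType R} (alpha : R) (U : {linear K -> K}) : Prop :=
  [/\ bounded_op U,
      forall x y, '[U x, y] = '[x, U y] &
      loewner_ge U (fun x => alpha *: x)].

Definition opinv {K : hilbertType R} (U : K -> K) : K -> K :=
  'pinv_(fun=> 0) [set: K] U.

(* Defined for a plain function so that it also applies to [opinv U]. *)
Definition normU {K : hilbertType R} (U : K -> K) (x : K) : R :=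
  Num.sqrt '[U x, x].

Definition weak_cvg {K : hilbertType R} (u : nat -> K) (l : K) : Prop :=
  forall y, '[u n, y] @[n --> \oo] --> '[l, y].

(* The Riesz representative of the Frechet differential. *)
Definition grad {H : hilbertType R} (h : H -> R^o) (x : H) : H :=
  xget 0 [set u : H | forall d, 'd h x d = '[d, u]].

End Operators.

Section ConvexAnalysis.
Context {R : realType}.
Local Open Scope ereal_scope.

Definition argmin {T : Type} (F : T -> \bar R) : set T :=
  [set x | forall y, F x <= F y].

Definition Gamma0 {K : hilbertType R} (f : K -> \bar R) : Prop :=
  [/\ forall x, -oo < f x,
      exists x, f x < +oo,
      lower_semicontinuous f &
      forall (x y : K) (t : R), (0 < t < 1)%R ->
        f (t *: x + (1 - t) *: y)%R <= t%:E * f x + (1 - t)%:E * f y].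

Definition conjugate {K : hilbertType R} (f : K -> \bar R) (u : K) : \bar R :=
  ereal_sup [set ('[x, u]%R)%:E - f x | x in [set: K]].

Definition infconv {K : hilbertType R} (f g : K -> \bar R) (x : K) : \bar R :=
  ereal_inf [set f y + g (x - y)%R | y in [set: K]].

Definition subdiff {K : hilbertType R} (f : K -> \bar R) (x : K) : set K :=
  [set u | forall y, ('[(y - x)%R, u]%R)%:E + f x <= f y].

Definition ran {X Y : Type} (T : X -> set Y) : set Y :=
  [set u | exists x, T x u].

(* The minimizer exists and is unique when [U] is in [Pcal alpha] with
   [alpha > 0], or is the inverse of such an operator, and [f] is in
   [Gamma0]. *)
Definition prox {K : hilbertType R} (U : K -> K) (f : K -> \bar R) (x : K) : K :=
  xget 0%R (argmin (fun y => f y + (2^-1 * normU U (x - y) ^+ 2)%R%:E)).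

Definition primal_obj {H : hilbertType R} (m : nat) (G : 'I_m -> hilbertType R)
    (z : H) (f : H -> \bar R) (h : H -> R^o) (r : forall i, G i)
    (g : forall i, G i -> \bar R) (L : forall i, {linear H -> G i})
    (x : H) : \bar R :=
  f x + \sum_(i < m) g i (L i x - r i)%R + (h x)%:E - ('[x, z]%R)%:E.

Definition dual_obj {H : hilbertType R} (m : nat) (G : 'I_m -> hilbertType R)
    (z : H) (f : H -> \bar R) (h : H -> R^o) (r : forall i, G i)
    (g : forall i, G i -> \bar R) (L : forall i, {linear H -> G i})
    (v : forall i, G i) : \bar R :=
  infconv (conjugate f) (conjugate (fun x => (h x)%:E))
    (z - \sum_(i < m) adjoint (L i) (v i))%R
  + \sum_(i < m) (conjugate (g i) (v i) + ('[v i, r i]%R)%:E).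

End ConvexAnalysis.

Section Sequences.
Context {R : realType}.

Definition l1_plus (a : nat -> R) : Prop :=
  (forall n, 0 <= a n) /\ (\sum_(0 <= n <oo) (a n)%:E < +oo)%E.

Definition abs_summable {K : hilbertType R} (a : nat -> K) : Prop :=
  (\sum_(0 <= n <oo) `|a n|%:E < +oo)%E.

(* [lag u0 u n] is the term of index [n - 1] of the sequence indexed from [-1]
   whose first term is [u0] and whose terms of index in [nat] are given by
   [u]. *)
Definition lag {T : Type} (u0 : T) (u : nat -> T) (n : nat) : T :=
  if n is k.+1 then u k else u0.

End Sequences.

(* Main.v *)
Require Import Defs.
From HB Require Import structures.
From mathcomp Require Import all_boot all_order all_algebra.
From mathcomp Require Import sesquilinear.
From mathcomp Require Import all_classical all_reals all_analysis.
From mathcomp Require Import ring lra.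
Set Implicit Arguments.
Unset Strict Implicit.
Unset Printing Implicit Defensive.
Import Order.TTheory GRing.Theory Num.Theory.
Import numFieldNormedType.Exports.
Local Open Scope classical_set_scope.
Local Open Scope ring_scope.

(** In the Hilbert sum [K] of [H] and the [G i], the optimality conditions say
    that [0] belongs to [A w + B w], where [A] is a translated product of
    subdifferentials (maximally monotone) and [B = (grad h, 0) + S], with [S] the
    skew operator built from the [L i], is monotone and [beta]-Lipschitzian.  The
    iteration is a forward-backward-forward splitting in which the first forward
    step reuses the previous evaluation [B (p (n - 1))].

    Let [W n] be the inverse of the metric operator, let [z] be a zero and let
    [pt n] be [p n] without its error [b n].  With
      [V n = <W n (x n - z), x n - z>], [T n = |x n - p (n - 1)|^2],
      [S n = |pt n - x n|^2] and [D n = |pt n - p (n - 1)|^2],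
    monotonicity gives, up to summable perturbations,
      [mu * V (n + 1) <= mu * V n - S n + (3/20) D n],
      [T (n + 1) <= (3/20) D n] and [D n <= 2 S n + 2 T n];
    the bound [lambda < 1 / (sqrt 10 * mu * beta)] provides the factor
    [3/20 = (3/2) * (1/10)].  Hence [V + T / (2 mu)] decreases by at least
    [(S n / 2 + D n / 40) / mu], up to summable perturbations, so that [S] and [D]
    are summable and [V n] converges.  Weak cluster points are zeros by Minty's
    trick, and they coincide because [W n] converges strongly (Opial). *)

(** * Inner products *)

(** One minimization supplies the existence results: the proximal point of [prox_exists] is the
    limit of near-minimizers, which strong convexity makes Cauchy. For a continuous linear function
    it gives Riesz vectors, hence adjoints, and the surjectivity of the metric operators; for a
    function in [Gamma0] it gives the proximal points of the algorithm and the resolvents behind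
    Minty's trick.

    Weak cluster points are limits along filters on the indices finer than [\oo]; ultrafilters
    replace the extraction of subsequences.

    The factor 3/2 is the price for separating a Lipschitz term from the errors: (s + r)^2 <= (3/2)
    s^2 + 3 r^2. When [T] has weight 1/2 next to [mu * V], the [D] terms add up to (1 + 1/2) (3/20)
    = 9/40. This is just below the 1/4 that D/4 <= S/2 + T/2 can absorb, and the 1/40 left over is
    what makes [D] summable.

    The metric changes with [n], and comparing the true iterate with an error-free one produces a
    cross term proportional to the distance to [z]. The descent therefore holds only up to a factor
    1 + d n with [d] summable, and a Robbins-Siegmund argument is required. *)

Section CauchySchwarz.
Context {R : realType} {V : lmodType R} (b : V -> V -> R).
Hypothesis bC : forall x y, b x y = b y x.
Hypothesis bP : forall a x y z, b (a *: x + y) z = a * b x z + b y z.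
Hypothesis b_ge0 : forall x, 0 <= b x x.

Lemma form_sqr (a : R) (x y : V) :
  b (a *: x + y) (a *: x + y) = a ^+ 2 * b x x + 2 * a * b x y + b y y.
Proof. by rewrite bP ![b _ (_ + _)]bC !bP (bC y x); ring. Qed.

(** The quadratic polynomial [H] in [a] is nonnegative. The form is only semidefinite, hence the
    separate case [b x x = 0]. A bare form is used so that the result serves the inner product, the
    operator metrics, and the product space before it has a norm. *)
Lemma form_cauchy_schwarz x y : b x y ^+ 2 <= b x x * b y y.
Proof.
have H a : 0 <= a ^+ 2 * b x x + 2 * a * b x y + b y y by rewrite -form_sqr.
have [x0|x0] := eqVneq (b x x) 0.
  have [->|xy] := eqVneq (b x y) 0; first by rewrite x0 expr2 !mul0r.
  (* The polynomial is affine in [a] when [b x x = 0]; at this point it equals -1. *)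
  have := H (- (b y y + 1) / (2 * b x y)).
  rewrite x0 mulr0 add0r.
  have -> : 2 * (- (b y y + 1) / (2 * b x y)) * b x y = - (b y y + 1) by field.
  lra.
have xp : 0 < b x x by rewrite lt_def x0 b_ge0.
have := H (- b x y / b x x).
have -> : (- b x y / b x x) ^+ 2 * b x x + 2 * (- b x y / b x x) * b x y + b y y
  = (b x x * b y y - b x y ^+ 2) / b x x by field.
by rewrite pmulr_lge0 ?invr_gt0// subr_ge0.
Qed.

End CauchySchwarz.

Section InnerProduct.
Context {R : realType} {K : hilbertType R}.
Implicit Types (x y z : K) (a : R).

Lemma innerC x y : '[x, y] = '[y, x].
Proof. by rewrite hermitian_subproof expr0 mul1r. Qed.

Lemma innerDl x y z : '[x + y, z] = '[x, z] + '[y, z].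
Proof. by rewrite linearDl. Qed.

Lemma innerZl a x z : '[a *: x, z] = a * '[x, z].
Proof. by rewrite linearZl_LR. Qed.

Lemma innerDr x y z : '[z, x + y] = '[z, x] + '[z, y].
Proof. by rewrite innerC innerDl !(innerC z). Qed.

Lemma innerZr a x z : '[z, a *: x] = a * '[z, x].
Proof. by rewrite innerC innerZl (innerC z). Qed.

Lemma innerNl x z : '[- x, z] = - '[x, z].
Proof. by rewrite -scaleN1r innerZl mulN1r. Qed.

Lemma innerNr x z : '[z, - x] = - '[z, x].
Proof. by rewrite -scaleN1r innerZr mulN1r. Qed.

Lemma innerBl x y z : '[x - y, z] = '[x, z] - '[y, z].
Proof. by rewrite innerDl innerNl. Qed.

Lemma innerBr x y z : '[z, x - y] = '[z, x] - '[z, y].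
Proof. by rewrite innerDr innerNr. Qed.

Lemma inner0l z : '[0, z] = 0 :> R.
Proof. by rewrite -(scale0r z) innerZl mul0r. Qed.

Lemma inner0r z : '[z, 0] = 0 :> R.
Proof. by rewrite innerC inner0l. Qed.

Lemma inner_suml (I : Type) (s : seq I) (P : pred I) (F : I -> K) z :
  '[\sum_(i <- s | P i) F i, z] = \sum_(i <- s | P i) '[F i, z].
Proof.
elim/big_rec2: _ => [|i u v _ <-]; [exact: inner0l | exact: innerDl].
Qed.

Lemma inner_ge0 x : 0 <= '[x, x].
Proof. by rewrite innerE sqr_ge0. Qed.

Lemma inner_sqr x y : '[x, y] ^+ 2 <= '[x, x] * '[y, y].
Proof.
apply: form_cauchy_schwarz; [exact: innerC | | exact: inner_ge0].
by move=> a u v w; rewrite innerDl innerZl.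
Qed.

Lemma inner_le x y : `|'[x, y]| <= `|x| * `|y|.
Proof.
rewrite -(@ler_pXn2r _ 2)// ?nnegrE ?mulr_ge0//.
by rewrite -normrX ger0_norm ?sqr_ge0// exprMn -!innerE inner_sqr.
Qed.

Lemma inner_ext x y : (forall z, '[x, z] = '[y, z]) -> x = y.
Proof.
move=> xy; apply/eqP; rewrite -subr_eq0 -normr_eq0 -sqrf_eq0.
by rewrite -innerE innerBl xy subrr.
Qed.

Lemma inner_continuous y : continuous (fun x : K => '[x, y]).
Proof.
move=> x; apply/cvgrPdist_le => /= e e0; near=> t.
rewrite -innerBl (le_trans (inner_le _ _))//.
have y1 : 0 < `|y| + 1 by rewrite ltr_wpDl.
rewrite (@le_trans _ _ (`|x - t| * (`|y| + 1)))//.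
  by rewrite ler_wpM2l// lerDl.
rewrite -ler_pdivlMr//; near: t.
by apply: cvgr_dist_le; rewrite ?divr_gt0.
Unshelve. all: by end_near. Qed.

Lemma inner_polarization x y : '[x, y] = 4^-1 * (`|x + y| ^+ 2 - `|x - y| ^+ 2).
Proof.
rewrite -!innerE !(innerDl, innerDr, innerNl, innerNr) (innerC y x).
by field.
Qed.

Lemma inner_cvg (T : Type) (F : set_system T) (FF : Filter F) (u v : T -> K) x y :
  u t @[t --> F] --> x -> v t @[t --> F] --> y -> '[u t, v t] @[t --> F] --> '[x, y].
Proof.
move=> ux vy; rewrite inner_polarization.
under eq_cvg do rewrite inner_polarization.
apply: cvgM; first exact: cvg_cst.
by apply: cvgB; apply: cvgM; apply: cvg_norm; [apply: cvgD|apply: cvgD|apply: cvgB|apply: cvgB].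
Qed.

End InnerProduct.

(** A vector identity is tested against an arbitrary vector, which turns it into an identity between
    scalars. *)
Ltac vector_ring :=
  apply: inner_ext => ?; rewrite !(innerDl, innerNl, innerZl, inner0l);
  first [ring | field].

(** * Hilbert direct sums *)

(** The alias carries the Hilbert structure, while any family [forall i, G i] is one of its elements
    by conversion. *)
Definition hsum {R : realType} {I : finType} (G : I -> hilbertType R) : Type :=
  forall i, G i.

Section HilbertSum.
Context {R : realType} {I : finType} (G : I -> hilbertType R).
Local Notation T := (hsum G).
Implicit Types (x y z : T) (a : R).

HB.instance Definition _ := gen_eqMixin T.
HB.instance Definition _ := gen_choiceMixin T.

Let add x y : T := fun i => x i + y i.
Let opp x : T := fun i => - x i.
Let zero : T := fun i => 0.
Let scale a x : T := fun i => a *: x i.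

Let addA : associative add.
Proof. by move=> x y z; apply: functional_extensionality_dep => i; exact: addrA. Qed.

Let addC : commutative add.
Proof. by move=> x y; apply: functional_extensionality_dep => i; exact: addrC. Qed.

Let add0 : left_id zero add.
Proof. by move=> x; apply: functional_extensionality_dep => i; exact: add0r. Qed.

Let addN : left_inverse zero opp add.
Proof. by move=> x; apply: functional_extensionality_dep => i; exact: addNr. Qed.

HB.instance Definition _ := GRing.isZmodule.Build T addA addC add0 addN.

Let scaleA a b x : scale a (scale b x) = scale (a * b) x.
Proof. by apply: functional_extensionality_dep => i; exact: scalerA. Qed.

Let scale1 : left_id 1 scale.
Proof. by move=> x; apply: functional_extensionality_dep => i; exact: scale1r. Qed.

Let scaleDr : right_distributive scale +%R.
Proof.
by move=> a x y; apply: functional_extensionality_dep => i; exact: scalerDr.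
Qed.

Let scaleDl x : {morph scale^~ x : a b / a + b}.
Proof.
by move=> a b; apply: functional_extensionality_dep => i; exact: scalerDl.
Qed.

HB.instance Definition _ := GRing.Zmodule_isLmodule.Build R T
  scaleA scale1 scaleDr scaleDl.

Definition hsum_inner x y : R := \sum_i '[x i, y i].

Let ip_linear z : linear_for *%R (hsum_inner ^~ z).
Proof.
move=> a x y; rewrite /hsum_inner mulr_sumr -big_split/=.
by apply: eq_bigr => i _; rewrite innerDl innerZl.
Qed.

Let ipC x y : hsum_inner x y = hsum_inner y x.
Proof. by apply: eq_bigr => i _; rewrite innerC. Qed.

Let ip_bilinear : bilinear_for
  (GRing.Scale.Law.clone _ _ *%R _) (GRing.Scale.Law.clone _ _ (idfun \; *%R) _)
  hsum_inner.
Proof.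
split=> z a x y /=; first exact: ip_linear.
by rewrite ![hsum_inner z _]ipC; exact: ip_linear.
Qed.

Let ip_ge0 x : 0 <= hsum_inner x x.
Proof. by apply: sumr_ge0 => i _; exact: inner_ge0. Qed.

Let ip_eq0 x : hsum_inner x x = 0 -> x = 0.
Proof.
move=> /eqP; rewrite psumr_eq0 => [/allP x0|i _]; last exact: inner_ge0.
apply: functional_extensionality_dep => i; have := x0 i (mem_index_enum _).
by rewrite /= innerE sqrf_eq0 normr_eq0 => /eqP.
Qed.

HB.instance Definition _ := @bilinear_isBilinear.Build R T T R _ _
  hsum_inner ip_bilinear.

Let ip_hermitian x y : hsum_inner x y = (-1) ^+ false * hsum_inner y x.
Proof. by rewrite expr0 mul1r; exact: ipC. Qed.

HB.instance Definition _ := @isHermitianSesquilinear.Build R T false idfun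
  hsum_inner ip_hermitian.

Let ip_gt0 x : x != 0 -> 0 < hsum_inner x x.
Proof. by rewrite lt_def ip_ge0 andbT; apply: contra => /eqP /ip_eq0 ->. Qed.

HB.instance Definition _ := @isDotProduct.Build R T hsum_inner ip_gt0.

Definition hsum_norm x : R := Num.sqrt (hsum_inner x x).

Let norm_sqr x : hsum_norm x ^+ 2 = hsum_inner x x.
Proof. by rewrite sqr_sqrtr. Qed.

Let ler_norm_add x y : hsum_norm (x + y) <= hsum_norm x + hsum_norm y.
Proof.
rewrite -(@ler_pXn2r _ 2)// ?nnegrE ?addr_ge0 ?sqrtr_ge0//.
have cs : hsum_inner x y <= hsum_norm x * hsum_norm y.
  rewrite (le_trans (ler_norm _))//.
  rewrite -(@ler_pXn2r _ 2)// ?nnegrE ?mulr_ge0 ?sqrtr_ge0//.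
  rewrite -normrX ger0_norm ?sqr_ge0// exprMn !norm_sqr.
  by apply: form_cauchy_schwarz => //; move=> *; exact: ip_linear.
rewrite sqrrD !norm_sqr -{1 2}[x]scale1r form_sqr//; last first.
  by move=> *; exact: ip_linear.
by lra.
Qed.

Let norm_scale a x : hsum_norm (a *: x) = `|a| * hsum_norm x.
Proof.
rewrite -sqrtr_sqr -sqrtrM ?sqr_ge0//; congr Num.sqrt.
rewrite /hsum_inner mulr_sumr; apply: eq_bigr => i _.
by rewrite innerZl innerZr mulrA.
Qed.

Let norm_eq0 x : hsum_norm x = 0 -> x = 0.
Proof. by move=> x0; apply: ip_eq0; rewrite -norm_sqr x0 expr0n. Qed.

HB.instance Definition _ := Lmodule_isNormed.Build R T
  ler_norm_add norm_scale norm_eq0.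

Lemma hsum_normE x : `|x| ^+ 2 = \sum_i `|x i| ^+ 2.
Proof.
by rewrite [LHS]norm_sqr; apply: eq_bigr => i _; rewrite innerE.
Qed.

Lemma hsum_coord_le x i : `|x i| <= `|x|.
Proof.
rewrite -(@ler_pXn2r _ 2)// ?nnegrE// hsum_normE (bigD1 i)//= lerDl.
by apply: sumr_ge0 => j _; exact: sqr_ge0.
Qed.

Lemma hsum_norm_le x : `|x| <= \sum_i `|x i|.
Proof.
rewrite -(@ler_pXn2r _ 2)// ?nnegrE ?sumr_ge0//.
rewrite hsum_normE expr2 big_distrl/=; apply: ler_sum => i _.
rewrite expr2 ler_wpM2l// (bigD1 i)//= lerDl.
by apply: sumr_ge0.
Qed.

Lemma hsum_complete (F : set_system T) : ProperFilter F -> cauchy F -> cvg F.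
Proof.
move=> FF /cauchyP Fc.
have Fi i : cvg ((fun x : T => x i) @ F).
  apply: cauchy_cvg; apply/cauchyP => e e0.
  have [x Fx] := Fc _ e0; exists (x i).
  change (F ((fun y : T => y i) @^-1` ball (x i) e)).
  apply: filterS Fx => y; rewrite /= -!ball_normE/=.
  exact: le_lt_trans (hsum_coord_le (x - y) i).
pose l : T := fun i => lim ((fun x : T => x i) @ F).
apply/cvg_ex; exists l; apply/cvgrPdist_le => e e0.
near=> x; apply: le_trans (hsum_norm_le _) _.
(* One share of [e] per coordinate and a spare one, so that the denominator is positive even for
   empty [I]. *)
have -> : e = \sum_(i : I) (e / #|I|.+1%:R) + e / #|I|.+1%:R.
  by rewrite sumr_const -mulrSr -[RHS]mulr_natr divfK// pnatr_eq0.
apply: ler_wpDr; first by rewrite divr_ge0// ltW.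
apply: ler_sum => i _; move: i.
near: x; apply: filter_forall => i.
have /cvgrPdist_le := Fi i; apply.
by rewrite divr_gt0.
Unshelve. all: by end_near. Qed.

HB.instance Definition _ := Uniform_isComplete.Build T hsum_complete.

Let innerE_hsum x : hsum_inner x x = `|x| ^+ 2.
Proof. by rewrite -norm_sqr. Qed.

HB.instance Definition _ := isHilbert.Build R T innerE_hsum.

Lemma hsum_innerE x y : '[x, y] = \sum_i '[x i, y i].
Proof. by []. Qed.

End HilbertSum.

(** * Self-adjoint and bounded operators, functions in [Gamma0] *)

Lemma cauchy_seq_cvg {R : realType} {K : hilbertType R} (u : nat -> K) :
  (forall e, 0 < e -> exists N, forall n, (N <= n)%N -> `|u N - u n| <= e) ->
  exists l : K, u n @[n --> \oo] --> l.
Proof.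
move=> uc; apply/cvg_ex; apply: cauchy_cvg; apply/cauchyP => e e0.
have e20 : 0 < e / 2 by rewrite divr_gt0.
have [N uN] := uc _ e20; exists (u N).
exists N => // n /= Nn; rewrite -ball_normE/=.
by rewrite (le_lt_trans (uN _ Nn))// gtr_pMr// invf_lt1// ltr1n.
Qed.

(** The limit t -> 0 taken by hand: if b < a, then at t = (a - b) / (2 (|c| + a - b)) the term t |c|
    stays below a - b. *)
Lemma le_add_smallM {R : realType} (a b c : R) :
  (forall t : R, 0 < t < 1 -> a <= b + t * c) -> a <= b.
Proof.
move=> H; rewrite leNgt; apply/negP => ba.
have c0 : 0 < `|c| + (a - b) by rewrite ltr_wpDl// subr_gt0.
have t1 : (a - b) / (2 * (`|c| + (a - b))) < 1.
  rewrite ltr_pdivrMr ?mulr_gt0// mul1r.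
  by have := normr_ge0 c; lra.
have t0 : 0 < (a - b) / (2 * (`|c| + (a - b))).
  by rewrite divr_gt0 ?mulr_gt0 ?subr_gt0.
have := H ((a - b) / (2 * (`|c| + (a - b)))); rewrite t0 t1 => /(_ isT).
apply/negP; rewrite -ltNge -ltrBrDl.
apply: (@le_lt_trans _ _ ((a - b) / (2 * (`|c| + (a - b))) * `|c|)).
  by rewrite ler_wpM2l ?(ltW t0)// ler_norm.
rewrite mulrAC ltr_pdivrMr ?mulr_gt0// ltr_pM2l ?subr_gt0//.
by have := normr_ge0 c; lra.
Qed.

Section SelfAdjoint.
Context {R : realType} {K : hilbertType R} (T : {linear K -> K}).
Hypothesis T_sym : forall x y, '[T x, y] = '[x, T y].
Implicit Types (x y : K) (a : R).

Lemma sym_form_sqr a x y :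
  '[T (a *: x + y), a *: x + y] =
  a ^+ 2 * '[T x, x] + 2 * a * '[T x, y] + '[T y, y].
Proof.
rewrite [T _]linearP !innerDl !innerDr !innerZl !innerZr (T_sym y x).
by rewrite (innerC y (T x)); ring.
Qed.

Lemma sym_form_sqrD x y :
  '[T (x + y), x + y] = '[T x, x] + 2 * '[T x, y] + '[T y, y].
Proof. by rewrite -[x]scale1r sym_form_sqr scale1r expr1n !mul1r mulr1. Qed.

Lemma sym_form_sqrB x y :
  '[T (x - y), x - y] = '[T x, x] - 2 * '[T x, y] + '[T y, y].
Proof.
by rewrite sym_form_sqrD [T (- _)]linearN !innerNl !innerNr opprK mulrN.
Qed.

Hypothesis T_ge0 : forall x, 0 <= '[T x, x].

Lemma psd_inner_sqr x y : '[T x, y] ^+ 2 <= '[T x, x] * '[T y, y].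
Proof.
apply: (form_cauchy_schwarz (b := fun x y => '[T x, y])) => //.
  by move=> u v; rewrite T_sym innerC.
by move=> a u v w; rewrite [T _]linearP innerDl innerZl.
Qed.

(** Cauchy-Schwarz for the form of [T] at [x] and [T x] gives |T x|^4 <= <T x, x> <T T x, T x> <= <T
    x, x> M |T x|^2. This converts bounds on quadratic forms into bounds on norms. *)
Lemma psd_norm_sqr (M : R) : (forall x, '[T x, x] <= M * `|x| ^+ 2) ->
  forall x, `|T x| ^+ 2 <= M * '[T x, x].
Proof.
move=> TM x; have [->|Tx0] := eqVneq (T x) 0.
  by rewrite normr0 expr0n inner0l mulr0.
have n0 : 0 < `|T x| ^+ 2 by rewrite exprn_gt0// normr_gt0.
rewrite -(ler_pM2r n0) -expr2 -{1}innerE.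
rewrite (le_trans (psd_inner_sqr _ _))//.
by rewrite [leRHS]mulrAC mulrC ler_wpM2r.
Qed.

End SelfAdjoint.

Section BoundedOperators.
Context {R : realType} {H G : hilbertType R} (L : {linear H -> G}).
Hypothesis L_bounded : bounded_op L.

Lemma bounded_opP : exists2 M, 0 < M & forall x, `|L x| <= M * `|x|.
Proof.
have /linear_boundedP LM := L_bounded; near +oo_R => M.
by exists M => //; near: M.
Unshelve. all: by end_near. Qed.

Let sup_L : has_sup [set `|L x| | x in [set x : H | `|x| <= 1]].
Proof.
have [M M0 LM] := bounded_opP.
split; first by exists `|L 0|, 0; rewrite //= normr0.
exists M => _ [x /= x1 <-]; rewrite (le_trans (LM x))//.
by rewrite ler_piMr// ltW.
Qed.

Lemma opnorm_ge0 : 0 <= opnorm L.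
Proof.
by apply: (sup_upper_bound sup_L); exists 0; rewrite /= ?linear0 ?normr0.
Qed.

Lemma opnorm_le x : `|L x| <= opnorm L * `|x|.
Proof.
have [->|x0] := eqVneq x 0; first by rewrite linear0 !normr0 mulr0.
have nx : 0 < `|x| by rewrite normr_gt0.
rewrite -ler_pdivrMr//; apply: (sup_upper_bound sup_L).
exists (`|x|^-1 *: x) => /=.
  by rewrite normrZ normfV normr_id mulVf// normr_eq0.
by rewrite linearZ/= normrZ normfV normr_id mulrC.
Qed.

End BoundedOperators.

Section Gamma0.
Context {R : realType} {K : hilbertType R} (f : K -> \bar R).
Hypothesis f0 : Gamma0 f.
Implicit Types (x y : K) (t : R).

Lemma Gamma0_fin x : (f x < +oo)%E -> f x = (fine (f x))%:E.
Proof. by case: f0 => fN _ _ _ fx; rewrite fineK// fin_numE gt_eqF// lt_eqF. Qed.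

Lemma Gamma0_proper : exists x r, f x = r%:E.
Proof. by case: (f0) => _ [x fx] _ _; exists x, (fine (f x)); exact: Gamma0_fin. Qed.

Lemma Gamma0_convex x y r s t : 0 < t < 1 -> f x = r%:E -> f y = s%:E ->
  exists2 v, f (t *: x + (1 - t) *: y) = v%:E & v <= t * r + (1 - t) * s.
Proof.
case: (f0) => _ _ _ cf t01 fx fy; have := cf x y t t01.
rewrite fx fy -!EFinM -EFinD => fle.
exists (fine (f (t *: x + (1 - t) *: y))).
  by apply: Gamma0_fin; rewrite (le_lt_trans fle)// ltry.
by rewrite -lee_fin -Gamma0_fin// (le_lt_trans fle)// ltry.
Qed.

(** Lower semicontinuity at a point [y] of the domain gives [f > r - 1] on a ball of radius [e]. For
    [x] outside the ball, convexity along the segment from [y] to [x] carries this bound outwards,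
    with slope 2 / e. The cone obtained is all the coercivity argument of [prox_exists] requires. *)
Lemma Gamma0_lower_bound x0 : exists c d, 0 <= d /\
  forall x, ((c - d * `|x - x0|)%:E <= f x)%E.
Proof.
have [y [r fy]] := Gamma0_proper.
have [_ _ + _] := f0 => /(_ y (r - 1)) []; first by rewrite fy lte_fin gtrBl.
move=> V /nbhs_normP [/= e e0 Ve] Vf.
have ballf x : `|y - x| < e -> ((r - 1)%:E < f x)%E by move=> ?; apply: Vf; exact: Ve.
pose d := 2 / e.
have d0 : 0 < d by rewrite divr_gt0.
exists (r - 1 - d * `|x0 - y|), d; split; first exact: ltW.
move=> x; apply: (@le_trans _ _ (r - 1 - d * `|x - y|)%:E).
  rewrite lee_fin -addrA lerD2l -opprD lerN2 -mulrDr ler_pM2l//.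
  by rewrite [leRHS]addrC ler_distD.
have [xy|xy] := ltP `|y - x| e.
  apply: le_trans (ltW (ballf _ xy)); rewrite lee_fin gerBl.
  by rewrite mulr_ge0// ltW.
have [fx|] := ltP (f x) +oo%E; last by rewrite leye_eq => /eqP ->; exact: leey.
have fxE := Gamma0_fin fx; move: fxE; set s := fine _ => fxE.
have xy0 : 0 < `|y - x| by exact: lt_le_trans xy.
(* the point at distance e/2 from y on the segment to x *)
pose t := (e / 2) / `|y - x|.
have t0 : 0 < t by rewrite !divr_gt0.
have t1 : t < 1 by rewrite ltr_pdivrMr// mul1r; lra.
have t01 : 0 < t < 1 by rewrite t0.
have [v fv vle] := Gamma0_convex t01 fxE fy.
have : ((r - 1)%:E < v%:E)%E.
  rewrite -fv; apply: ballf.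
  have -> : y - (t *: x + (1 - t) *: y) = t *: (y - x).
    by vector_ring.
  by rewrite normrZ gtr0_norm// divfK ?gt_eqF//; lra.
rewrite lte_fin fxE lee_fin => rv.
have td : t * (d * `|x - y|) = 1.
  have n0 : `|x - y| != 0 by rewrite distrC gt_eqF.
  have e1 : e != 0 by rewrite gt_eqF.
  by rewrite /t /d distrC; field; rewrite ?n0 ?e1.
rewrite -(ler_pM2l t0); nra.
Qed.

End Gamma0.

(** * Proximity operators, Riesz representation, inverses *)

Section Prox.
Context {R : realType} {K : hilbertType R}.
Context (W : {linear K -> K}) (c C : R).
Hypothesis W_sym : forall x y, '[W x, y] = '[x, W y].
Hypothesis c_gt0 : 0 < c.
Hypothesis W_ge : forall x : K, c * `|x| ^+ 2 <= '[W x, x].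
Hypothesis W_le : forall x, '[W x, x] <= C * `|x| ^+ 2.
Context (f : K -> \bar R).
Hypothesis f0 : Gamma0 f.
Implicit Types (x y : K) (t : R).

Let W_ge0 x : 0 <= '[W x, x].
Proof. by apply: le_trans (W_ge x); rewrite mulr_ge0 ?sqr_ge0// ltW. Qed.

Lemma psd_bounded x : `|W x| <= C * `|x|.
Proof.
have [->|x0] := eqVneq x 0; first by rewrite linear0 !normr0 mulr0.
have x2 : 0 < `|x| ^+ 2 by rewrite exprn_gt0// normr_gt0.
have C0 : 0 <= C by have := le_trans (W_ge0 x) (W_le x); rewrite pmulr_lge0.
rewrite -(@ler_pXn2r _ 2)// ?nnegrE ?mulr_ge0// exprMn.
rewrite (le_trans (psd_norm_sqr W_sym W_ge0 W_le x))//.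
by rewrite expr2 -mulrA ler_wpM2l.
Qed.

Lemma psd_continuous : continuous W.
Proof.
apply: bounded_linear_continuous; apply/linear_boundedP.
exists C; split; first exact: num_real.
move=> r Cr x; apply: le_trans (psd_bounded x) _.
by rewrite ler_wpM2r// ltW.
Qed.

Lemma normU_sqr x : normU W x ^+ 2 = '[W x, x].
Proof. by rewrite sqr_sqrtr. Qed.

Let q x y := 2^-1 * '[W (x - y), x - y].

(** The parallelogram identity in the metric [W]; the subtracted term measures strong convexity. *)
Let q_mid x a b : q x (2^-1 *: a + (1 - 2^-1) *: b) =
  2^-1 * (q x a + q x b) - 8^-1 * '[W (a - b), a - b].
Proof.
rewrite /q.
have -> : x - (2^-1 *: a + (1 - 2^-1) *: b) = 2^-1 *: ((x - a) + (x - b)).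
  by vector_ring.
have -> : a - b = (x - b) - (x - a) by vector_ring.
move: (x - a) (x - b) => u v.
rewrite (sym_form_sqrB W_sym) [W (_ *: _)]linearZ innerZl innerZr.
by rewrite (sym_form_sqrD W_sym) (W_sym v u) (innerC v (W u)); field.
Qed.

(** By [q_mid], two near-minimizers are close, since otherwise their midpoint would fall below the
    infimum. A minimizing sequence thus converges in norm, and lower semicontinuity passes to the
    limit. *)
Lemma prox_exists x :
  exists p, argmin (fun y => f y + (2^-1 * normU W (x - y) ^+ 2)%:E)%E p.
Proof.
pose S := [set r | exists2 y, f y = (r - q x y)%:E & True].
have [y0 [r0 fy0]] := Gamma0_proper f0.
have [a [d [d0 fge]]] := Gamma0_lower_bound f0 x.
have infS : has_inf S.
  split; first by exists (r0 + q x y0), y0; rewrite // addrK.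
  (* Here d^2 / (2 c) is the largest value of d n - (c / 2) n^2, by completing the square. *)
  exists (a - d ^+ 2 / (2 * c)) => r [y fy _].
  have := fge y; rewrite fy lee_fin lerBrDr distrC => h.
  apply: le_trans h; rewrite -addrA lerD2l.
  have := W_ge (x - y); rewrite /q; set n := `|x - y| => Wn.
  apply: (@le_trans _ _ (- (d * n) + 2^-1 * (c * n ^+ 2))); last first.
    by rewrite lerD2l ler_pM2l.
  rewrite -subr_ge0.
  have -> : - (d * n) + 2^-1 * (c * n ^+ 2) - - (d ^+ 2 / (2 * c)) =
    (c * n - d) ^+ 2 / (2 * c) by field; rewrite gt_eqF.
  by rewrite divr_ge0 ?sqr_ge0// mulr_ge0// ltW.
pose m := inf S.
have m_le y r : f y = r%:E -> m <= r + q x y.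
  by move=> fy; apply: (inf_lbound infS.2); exists y; rewrite // addrK.
pose eps n : R := n.+1%:R^-1.
have near_inf (n : nat) : exists y r, f y = r%:E /\ r + q x y <= m + eps n.
  have [|r [y fy _] rm] := @inf_adherent _ S (eps n) _ infS.
    by rewrite invr_gt0.
  by exists y, (r - q x y); split=> //; rewrite subrK ltW.
have [u /choice[r ur]] := choice near_inf.
have fu n : f (u n) = (r n)%:E by case: (ur n).
have ru n : r n + q x (u n) <= m + eps n by case: (ur n).
have u_dist n k : 8^-1 * (c * `|u n - u k| ^+ 2) <= 2^-1 * (eps n + eps k).
  have h2 : 0 < (2^-1 : R) < 1 by lra.
  have [v fv vle] := Gamma0_convex f0 h2 (fu n) (fu k).
  have := m_le _ _ fv; rewrite q_mid => mv.
  have := W_ge (u n - u k); have := ru n; have := ru k.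
  lra.
have [p up] : exists p : K, u n @[n --> \oo] --> p.
  apply: cauchy_seq_cvg => e e0.
  have [N _ Ne] : \forall n \near \oo, eps n <= c * e ^+ 2 / 8 :> R.
    have : (n.+1%:R^-1 : R) @[n --> \oo] --> 0 by exact: cvg_harmonic.
    move=> /cvgrPdist_le /(_ (c * e ^+ 2 / 8)).
    rewrite !mulr_gt0 ?exprn_gt0// => /(_ isT); apply: filterS => n.
    by rewrite sub0r normrN gtr0_norm ?invr_gt0.
  exists N => n Nn; rewrite -(@ler_pXn2r _ 2)// ?nnegrE ?(ltW e0)//.
  rewrite -(ler_pM2l c_gt0).
  have := u_dist N n; have := Ne N (leqnn N); have := Ne n Nn. lra.
have qup : q x (u n) @[n --> \oo] --> q x p.
  have h : (x - u n) @[n --> \oo] --> x - p by apply: cvgB => //; exact: cvg_cst.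
  apply: cvgM; first exact: cvg_cst.
  apply: inner_cvg => //; exact: (cvg_comp _ _ h (@psd_continuous (x - p))).
(* Since [f p] may be infinite a priori, lower semicontinuity is applied to each real [b] below
   it. *)
have fp b : (b%:E < f p)%E -> b + q x p <= m.
  move=> bp; have [_ _ + _] := f0 => /(_ p b bp) [V Vp Vf].
  have mcvg : (m + n.+1%:R^-1) @[n --> \oo] --> m.
    by rewrite -{2}[m]addr0; apply: cvgD; [exact: cvg_cst|exact: cvg_harmonic].
  apply: (ler_cvg_to (cvgD (cvg_cst b) qup) mcvg).
  near=> n; have Vn : V (u n) by near: n; exact: up.
  rewrite (le_trans _ (ru n))// lerD2r.
  by have := Vf _ Vn; rewrite fu lte_fin => /ltW.
exists p => y; rewrite !normU_sqr -/(q x p) -/(q x y).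
have fp_le : (f p <= (m - q x p)%:E)%E.
  rewrite leNgt; apply/negP => mp.
  have [b mb bp] : exists2 b, m - q x p < b & (b%:E < f p)%E.
    move: mp; case: (f p) => [s|_|//]; last by exists (m - q x p + 1); rewrite ?ltrDl ?ltry.
    by rewrite lte_fin => ms; exists ((m - q x p + s) / 2); rewrite ?lte_fin; lra.
  by have := fp _ bp; lra.
have [fy|] := ltP (f y) +oo%E; last first.
  by rewrite leye_eq => /eqP ->; rewrite addye// leey.
rewrite (Gamma0_fin f0 fy).
have fpf : (f p < +oo)%E by rewrite (le_lt_trans fp_le)// ltry.
rewrite (Gamma0_fin f0 fpf) -!EFinD lee_fin.
have := m_le _ _ (Gamma0_fin f0 fy).
move: fp_le; rewrite {1}(Gamma0_fin f0 fpf) lee_fin; lra.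
Unshelve. all: by end_near. Qed.

(** Comparing [p] with the points t y + (1 - t) p and using the convexity of [f] gives the
    subgradient inequality up to a term of order t, which [le_add_smallM] removes. *)
Lemma argmin_subdiff x p :
  argmin (fun y => f y + (2^-1 * normU W (x - y) ^+ 2)%:E)%E p ->
  subdiff f p (W (x - p)).
Proof.
move=> pmin.
have [y0 [r0 fy0]] := Gamma0_proper f0.
have fpoo : (f p < +oo)%E.
  have := pmin y0; rewrite fy0 -EFinD; case: (f p) => [s|//|//].
  by rewrite ltry.
have fp := Gamma0_fin f0 fpoo; set s := fine _ in fp.
move=> y; have [fyoo|] := ltP (f y) +oo%E; last first.
  by rewrite leye_eq => /eqP ->; rewrite leey.
have fy := Gamma0_fin f0 fyoo; set r := fine _ in fy.
rewrite fp fy -EFinD lee_fin.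
apply: (@le_add_smallM _ _ _ (2^-1 * '[W (y - p), y - p])) => t t01.
have [v fv vle] := Gamma0_convex f0 t01 fy fp.
have := pmin (t *: y + (1 - t) *: p).
rewrite fp fv -!EFinD lee_fin !normU_sqr.
have -> : x - (t *: y + (1 - t) *: p) = - t *: (y - p) + (x - p) by vector_ring.
rewrite sym_form_sqr// (W_sym (y - p) (x - p)) sqrrN => le1.
have /andP[t0 t1] := t01.
rewrite -(ler_pM2l t0); lra.
Qed.

End Prox.

Section Riesz.
Context {R : realType} {K : hilbertType R}.

Section LinearFunctional.
Context (l : K -> R).
Hypothesis l_linear : forall a x y, l (a *: x + y) = a * l x + l y.
Hypothesis l_continuous : continuous l.

Lemma Gamma0_linear : Gamma0 (fun x => (l x)%:E).
Proof.
split=> [x||x a|x y t _].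
- exact: ltNyr.
- by exists 0; exact: ltry.
- rewrite lte_fin => ax; exists [set y | a < l y]; last by move=> y; rewrite lte_fin.
  have lx : l @ x --> l x by exact: l_continuous.
  exact: (cvgr_gt _ lx).
- rewrite -!EFinM -EFinD lee_fin l_linear.
  have := l_linear (1 - t) y 0; rewrite addr0 => ->.
  by have := l_linear 1 0 0; rewrite mul1r scale1r addr0; lra.
Qed.

(** The subgradient inequality at p + d and at p - d gives the two opposite bounds. *)
Lemma subdiff_linear p u : subdiff (fun x => (l x)%:E) p u ->
  forall d, l d = '[d, u].
Proof.
have l0 : l 0 = 0 by have := l_linear 1 0 0; rewrite mul1r scale1r addr0; lra.
have le d : subdiff (fun x => (l x)%:E) p u -> '[d, u] <= l d.
  move=> /(_ (d + p)); rewrite addrK -EFinD lee_fin.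
  by have := l_linear 1 d p; rewrite scale1r mul1r; lra.
move=> pu d; apply/eqP; rewrite eq_le le// andbT.
have := le (- d) pu; rewrite innerNl.
by have := l_linear (-1) d 0; rewrite addr0 scaleN1r l0; lra.
Qed.

End LinearFunctional.

(** The proximal point [p] of <., b> at 0 in the metric [U] satisfies U (0 - p) = b. *)
Lemma sym_surjective (U : {linear K -> K}) (c C : R) (b : K) :
  (forall x y, '[U x, y] = '[x, U y]) -> 0 < c ->
  (forall x, c * `|x| ^+ 2 <= '[U x, x]) ->
  (forall x, '[U x, x] <= C * `|x| ^+ 2) -> exists x, U x = b.
Proof.
move=> Us c0 Uc UC.
have bl a x y : '[a *: x + y, b] = a * '[x, b] + '[y, b] by rewrite innerDl innerZl.
have bG := Gamma0_linear bl (@inner_continuous _ _ b).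
have [p /(argmin_subdiff Us c0 Uc bG) pb] := prox_exists Us c0 Uc UC bG 0.
exists (- p); apply: inner_ext => z; rewrite innerC -sub0r.
by rewrite -(subdiff_linear bl pb) innerC.
Qed.

(** If [p] is the proximal point of [l] at 0 for the identity metric, then 0 - p is a subgradient of
    [l] and so represents it. *)
Lemma riesz (l : K -> R) : (forall a x y, l (a *: x + y) = a * l x + l y) ->
  continuous l -> exists u, forall x, l x = '[x, u].
Proof.
move=> ll lc; have lG := Gamma0_linear ll lc.
pose I : {linear K -> K} := idfun.
have Is x y : '[I x, y] = '[x, I y] by [].
have Ige x : 1 * `|x| ^+ 2 <= '[I x, x] by rewrite mul1r innerE.
have Ile x : '[I x, x] <= 1 * `|x| ^+ 2 by rewrite mul1r innerE.
have [p /(argmin_subdiff Is ltr01 Ige lG) lp] := prox_exists Is ltr01 Ige Ile lG 0.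
by exists (I (0 - p)); exact: subdiff_linear lp.
Qed.

End Riesz.

Section Adjoint.
Context {R : realType} {H G : hilbertType R} (L : {linear H -> G}).
Hypothesis L_bounded : bounded_op L.

Lemma adjointP v x : '[L x, v] = '[x, adjoint L v].
Proof.
have [M M0 LM] := bounded_opP L_bounded.
have lL a x1 x2 : '[L (a *: x1 + x2), v] = a * '[L x1, v] + '[L x2, v].
  by rewrite [L _]linearP innerDl innerZl.
have cL : continuous (fun x => '[L x, v]).
  move=> y; apply: (@cvg_comp _ _ _ L (fun z => '[z, v])); last exact: inner_continuous.
  exact: bounded_linear_continuous.
have [u Lu] := riesz lL cL.
move: x; exact: (xgetPex (0 : H) (ex_intro (fun u => forall x, '[L x, v] = '[x, u]) u Lu)).
Qed.

End Adjoint.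

Section Inverse.
Context {R : realType} {K : hilbertType R} (alpha : R) (U : {linear K -> K}).
Hypothesis alpha_gt0 : 0 < alpha.
Hypothesis U_Pcal : Pcal alpha U.

Let U_sym x y : '[U x, y] = '[x, U y].
Proof. by case: U_Pcal. Qed.

Let U_ge x : alpha * `|x| ^+ 2 <= '[U x, x].
Proof. by case: U_Pcal => _ _ /(_ x); rewrite innerZl innerE. Qed.

Let U_le x : '[U x, x] <= opnorm U * `|x| ^+ 2.
Proof.
case: U_Pcal => bU _ _; rewrite (le_trans (ler_norm _))//.
by rewrite (le_trans (inner_le _ _))// expr2 mulrA ler_wpM2r// opnorm_le.
Qed.

Lemma Pcal_inj : injective U.
Proof.
move=> x y /eqP; rewrite -subr_eq0 -linearB => /eqP Uxy; apply/eqP.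
have := U_ge (x - y); rewrite Uxy inner0l pmulr_rle0// => xy.
by rewrite -subr_eq0 -normr_eq0 -sqrf_eq0 eq_le xy sqr_ge0.
Qed.

Lemma opinvK : cancel (opinv U) U.
Proof.
move=> b; have [x Ux] := sym_surjective b U_sym alpha_gt0 U_ge U_le.
by rewrite /opinv pinvK// inE; exists x.
Qed.

Lemma opinv_can : cancel U (opinv U).
Proof. by move=> x; apply: Pcal_inj; rewrite opinvK. Qed.

Lemma opinv_linear : exists W : {linear K -> K}, W = opinv U :> (K -> K).
Proof.
have lW : linear (opinv U).
  by move=> a x y; apply: Pcal_inj; rewrite opinvK linearP !opinvK.
pose m := GRing.isLinear.Build R K K *:%R (opinv U) lW.
by exists (HB.pack_for {linear K -> K} (opinv U) m).
Qed.

Lemma opinv_sym x y : '[opinv U x, y] = '[x, opinv U y].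
Proof. by rewrite -{1}(opinvK y) -U_sym opinvK. Qed.

(** This is [psd_norm_sqr] for [U] at [opinv U x]. *)
Lemma opinv_ge (M : R) : opnorm U <= M -> forall x, `|x| ^+ 2 <= M * '[opinv U x, x].
Proof.
move=> UM x; have U0 y : 0 <= '[U y, y].
  by rewrite (le_trans _ (U_ge y))// mulr_ge0 ?sqr_ge0// ltW.
have := psd_norm_sqr U_sym U0 U_le (opinv U x); rewrite opinvK => /le_trans; apply.
rewrite innerC ler_wpM2r//.
by rewrite -{2}(opinvK x) innerC.
Qed.

(** Coercivity of [U] at [opinv U x], combined with (|x| - alpha |opinv U x|)^2 >= 0. *)
Lemma opinv_le x : '[opinv U x, x] <= alpha^-1 * `|x| ^+ 2.
Proof.
have := U_ge (opinv U x); rewrite opinvK => h1.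
have h2 := le_trans (ler_norm _) (inner_le x (opinv U x)).
rewrite ler_pdivlMl// innerC.
have := sqr_ge0 (`|x| - alpha * `|opinv U x|).
have := ler_wpM2l (ltW alpha_gt0) h1; have := ler_wpM2l (ltW alpha_gt0) h2; lra.
Qed.

End Inverse.

(** * Resolvents and conjugates *)

(** An infinite value makes the right-hand side +oo, so convexity has to be checked on finite values
    only. *)
Lemma convex_ereal {R : realType} (a b m : \bar R) (t : R) : 0 < t < 1 ->
  (-oo < a)%E -> (-oo < b)%E ->
  (forall r s, a = r%:E -> b = s%:E -> (m <= (t * r + (1 - t) * s)%:E)%E) ->
  (m <= t%:E * a + (1 - t)%:E * b)%E.
Proof.
move=> /andP[t0 t1] aN bN H.
have t0' : (0 < t%:E)%E by rewrite lte_fin.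
have t1' : (0 < (1 - t)%:E)%E by rewrite lte_fin subr_gt0.
case: a aN H => [r _|_ _|//].
  case: b bN => [s _ H|_ _|//]; first by rewrite -!EFinM -EFinD; exact: H.
  by rewrite gt0_muley// -EFinM addey// leey.
rewrite gt0_muley// addye ?leey//.
case: b bN => [s _|_|//]; first by rewrite -EFinM.
by rewrite gt0_muley.
Qed.

Section Resolvent.
Context {R : realType} {K : hilbertType R}.
Implicit Types (x y u : K) (f : K -> \bar R).

Lemma Gamma0_scale f (c : R) : 0 < c -> Gamma0 f ->
  Gamma0 (fun x => c%:E * f x)%E.
Proof.
move=> c0 f0; have [fN [x0 fx0] flsc _] := f0.
have c0' : (0 < c%:E)%E by rewrite lte_fin.
have cfin x r : (c%:E * f x = r%:E)%E -> f x = (c^-1 * r)%:E.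
  have := fN x; case: (f x) => [s _|_|//]; last by rewrite gt0_muley.
  by rewrite -EFinM => -[<-]; rewrite mulKf ?gt_eqF.
have cN x : (-oo < c%:E * f x)%E.
  by have := fN x; case: (f x) => [r _|_|//]; rewrite ?gt0_muley ?ltNyr.
split=> [//||x a|x y t t01].
- by exists x0; rewrite (Gamma0_fin f0 fx0) -EFinM ltry.
- have scaleE y (b : R) : (b%:E < c%:E * f y)%E = ((c^-1 * b)%:E < f y)%E.
    have := fN y; case: (f y) => [r _|_|//]; last by rewrite gt0_muley// !ltry.
    by rewrite -EFinM !lte_fin ltr_pdivrMl.
  rewrite scaleE => /flsc[V Vx Vf]; exists V => // y Vy.
  by rewrite scaleE; exact: Vf.
- apply: convex_ereal => // r s /cfin fx /cfin fy.
  have [v -> vle] := Gamma0_convex f0 t01 fx fy.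
  rewrite -EFinM lee_fin -ler_pdivlMl//; lra.
Qed.

Lemma subdiff_fin f x u : Gamma0 f -> subdiff f x u -> f x = (fine (f x))%:E.
Proof.
move=> f0 fxu; apply: Gamma0_fin => //.
have [y0 [r0 fy0]] := Gamma0_proper f0.
have := fxu y0; rewrite fy0; case: (f x) => [s|//|//].
by rewrite ltry.
Qed.

Lemma subdiff_scale f (c : R) x u : 0 < c -> Gamma0 f ->
  subdiff (fun x => c%:E * f x)%E x u -> subdiff f x (c^-1 *: u).
Proof.
move=> c0 f0 fxu y; have fc0 := Gamma0_scale c0 f0.
have c0' : (0 < c%:E)%E by rewrite lte_fin.
have [fN _ _ _] := f0.
have : f x = (fine (f x))%:E.
  have := subdiff_fin fc0 fxu; have := fN x; case: (f x) => [s|_|//] //=.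
  by rewrite gt0_muley.
move: (fine _) => r fx.
have := fxu y; have := fN y; rewrite fx; case: (f y) => [s _|_ _|//]; last by rewrite leey.
rewrite -!EFinM -!EFinD !lee_fin innerZr => h.
by rewrite -(ler_pM2l c0) mulrDr mulrA mulfV ?gt_eqF// mul1r.
Qed.

Lemma resolvent_exists f (c : R) x : 0 < c -> Gamma0 f ->
  exists p, subdiff f p (c^-1 *: (x - p)).
Proof.
move=> c0 f0; pose I : {linear K -> K} := idfun.
have Is y z : '[I y, z] = '[y, I z] by [].
have Ige y : 1 * `|y| ^+ 2 <= '[I y, y] by rewrite mul1r innerE.
have Ile y : '[I y, y] <= 1 * `|y| ^+ 2 by rewrite mul1r innerE.
have fc0 := Gamma0_scale c0 f0.
have [p /(argmin_subdiff Is ltr01 Ige fc0) fp] := prox_exists Is ltr01 Ige Ile fc0 x.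
by exists p; exact: subdiff_scale.
Qed.

Lemma prox_subdiff (alpha : R) (U : {linear K -> K}) f (c : R) x :
  0 < alpha -> Pcal alpha U -> 0 < c -> Gamma0 f ->
  let p := prox (opinv U) (fun w => c%:E * f w)%E x in
  subdiff f p (c^-1 *: opinv U (x - p)).
Proof.
move=> alpha0 PU c0 f0 p; have fc0 := Gamma0_scale c0 f0.
have [W WU] := opinv_linear alpha0 PU.
have Ws y z : '[W y, z] = '[y, W z] by rewrite WU; exact: opinv_sym PU _ _.
(* The maximum with 1 keeps [M] positive when [K] is trivial and [opnorm U] vanishes. *)
pose M := Num.max (opnorm U) 1.
have M0 : 0 < M by rewrite lt_max ltr01 orbT.
have Wge y : M^-1 * `|y| ^+ 2 <= '[W y, y].
  by rewrite ler_pdivrMl// WU (opinv_ge alpha0 PU)// le_max lexx.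
have Wle y : '[W y, y] <= alpha^-1 * `|y| ^+ 2.
  by rewrite WU; exact: opinv_le PU _.
apply: subdiff_scale => //; rewrite -WU.
have M0' : 0 < M^-1 by rewrite invr_gt0.
apply: (argmin_subdiff Ws M0' Wge fc0).
by rewrite /p -WU; exact: (xgetPex _ (prox_exists Ws M0' Wge Wle fc0 x)).
Qed.

Lemma subdiff_monotone f x y u v : Gamma0 f -> subdiff f x u -> subdiff f y v ->
  0 <= '[x - y, u - v].
Proof.
move=> f0 fxu fyv; have := fxu y; have := fyv x.
rewrite (subdiff_fin f0 fxu) (subdiff_fin f0 fyv) -!EFinD !lee_fin.
by rewrite !innerBl !innerBr; lra.
Qed.

End Resolvent.

Section Conjugate.
Context {R : realType} {K : hilbertType R} (f : K -> \bar R).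
Implicit Types (x y u : K).

Lemma conjugate_leP u (r : R) : (forall x, -oo < f x)%E ->
  (conjugate f u <= r%:E)%E <-> (forall x w, f x = w%:E -> '[x, u] - w <= r).
Proof.
move=> fN; split=> [fu x w fx|H].
  rewrite -lee_fin; apply: le_trans fu; apply: ereal_sup_ubound.
  by exists x => //; rewrite fx.
apply: ge_ereal_sup => _ [x _ <-]; have := fN x.
case fx : (f x) => [w|//|//] _; last by rewrite leNye.
by rewrite lee_fin; exact: H.
Qed.

Hypothesis f0 : Gamma0 f.

Let fN x : (-oo < f x)%E.
Proof. by case: f0. Qed.

Lemma conjugate_gtNy u : (-oo < conjugate f u)%E.
Proof.
have [x [r fx]] := Gamma0_proper f0.
apply: (@lt_le_trans _ _ ('[x, u] - r)%:E); first exact: ltNyr.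
by apply: ereal_sup_ubound; exists x => //; rewrite fx.
Qed.

(** A supremum of continuous affine functions is convex and lower semicontinuous. The finite value
    that properness asks for is supplied, at each use, by a subgradient of [f]. *)
Lemma Gamma0_conjugate : (exists u, conjugate f u < +oo)%E -> Gamma0 (conjugate f).
Proof.
move=> fu; split=> [u||u a|u v t t01] //; first exact: conjugate_gtNy.
  move=> /ereal_sup_gt[_ [x _ <-]].
  have := fN x; case fx : (f x) => [w|//|//] _.
  rewrite lte_fin => axu.
  have xu : '[y, x] @[y --> u] --> '[u, x] by exact: inner_continuous.
  exists [set y | a + w < '[y, x]].
    by apply: (cvgr_gt _ xu); rewrite innerC -ltrBrDr.
  move=> y; rewrite /= innerC => axy; apply: (@lt_le_trans _ _ ('[x, y] - w)%:E).
    by rewrite lte_fin ltrBrDr.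
  by apply: ereal_sup_ubound; exists x => //; rewrite fx.
apply: convex_ereal => //; try exact: conjugate_gtNy.
move=> r s fr fs; apply/conjugate_leP => // x w fx.
have /conjugate_leP -/(_ fN x w fx) : (conjugate f u <= r%:E)%E by rewrite fr.
have /conjugate_leP -/(_ fN x w fx) : (conjugate f v <= s%:E)%E by rewrite fs.
rewrite innerDr !innerZr; have /andP[t0 t1] := t01; nra.
Qed.

Lemma conjugate_subdiffE x u : subdiff f x u ->
  conjugate f u = ('[x, u] - fine (f x))%:E.
Proof.
move=> fxu; have fx := subdiff_fin f0 fxu.
apply/eqP; rewrite eq_le; apply/andP; split.
  apply/conjugate_leP => // y w fy; have := fxu y.
  by rewrite fy fx -EFinD lee_fin innerBl; lra.
by apply: ereal_sup_ubound; exists x => //; rewrite fx.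
Qed.

Lemma subdiff_conjugate x u : subdiff f x u -> subdiff (conjugate f) u x.
Proof.
move=> fxu v; rewrite (conjugate_subdiffE fxu) -EFinD.
apply: (@le_trans _ _ ('[x, v] - fine (f x))%:E).
  by rewrite lee_fin innerBl (innerC v) (innerC u); lra.
by apply: ereal_sup_ubound; exists x => //; rewrite {1}(subdiff_fin f0 fxu).
Qed.

(* [p := prox_f (x + u)] gives [x + u - p \in subdiff f p]; monotonicity of the
   subdifferential of the conjugate then forces [p = x]. *)
Lemma subdiff_of_conjugate x u : subdiff (conjugate f) u x -> subdiff f x u.
Proof.
move=> fux; have [p fp] := resolvent_exists (x + u) ltr01 f0.
rewrite invr1 scale1r in fp.
have fc := subdiff_conjugate fp.
have f0c : Gamma0 (conjugate f).
  by apply: Gamma0_conjugate; exists (x + u - p); rewrite (conjugate_subdiffE fp) ltry.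
have := subdiff_monotone f0c fux fc.
have -> : u - (x + u - p) = - (x - p) by vector_ring.
rewrite innerNl innerE oppr_ge0 => xp0.
have /eqP : `|x - p| ^+ 2 == 0 by rewrite eq_le xp0 sqr_ge0.
move=> /eqP; rewrite sqrf_eq0 normr_eq0 subr_eq0 => /eqP xp.
by move: fp; rewrite -xp addrAC subrr add0r.
Qed.

End Conjugate.

(** With a and b the images of x under the inverses of U and V, Cauchy-Schwarz for U gives <b, x>^2
    = <U b, a>^2 <= <U b, b> <a, x> <= c <b, x> <a, x>, and <b, x> cancels. *)
Lemma opinv_antitone {R : realType} {K : hilbertType R} (alpha c : R)
    (U V : {linear K -> K}) : 0 < alpha -> Pcal alpha U -> Pcal alpha V ->
  0 <= c -> loewner_ge (fun x => c *: V x) U ->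
  forall x, '[opinv V x, x] <= c * '[opinv U x, x].
Proof.
move=> alpha0 PU PV c0 cVU x.
have Usym y z : '[U y, z] = '[y, U z] by case: PU.
have U0 y : 0 <= '[U y, y].
  case: PU => _ _ /(_ y); apply: le_trans.
  by rewrite innerZl mulr_ge0 ?inner_ge0// ltW.
set a := opinv U x; set b := opinv V x.
have xE : x = U a by rewrite /a (opinvK alpha0 PU).
have xE' : x = V b by rewrite /b (opinvK alpha0 PV).
have bx : '[b, x] = '[U b, a] by rewrite [in LHS]xE Usym.
have ax : '[a, x] = '[U a, a] by rewrite {1}xE Usym.
have bx0 : 0 <= '[b, x].
  rewrite xE' innerC; case: PV => _ _ /(_ b); apply: le_trans.
  by rewrite innerZl mulr_ge0 ?inner_ge0// ltW.
have ax0 : 0 <= '[a, x] by rewrite ax.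
have := psd_inner_sqr Usym U0 b a; rewrite -bx -ax => h.
have := cVU b; rewrite innerZl -xE' innerC (innerC x b) => h2.
have [b0|bn0] := eqVneq '[b, x] 0; first by rewrite b0 mulr_ge0.
have bp : 0 < '[b, x] by rewrite lt_def bn0.
rewrite -(ler_pM2l bp) -expr2 (le_trans h)//.
by rewrite mulrCA mulrA ler_wpM2r// innerC.
Qed.

(** * Summable sequences *)

Section BoundedSeries.
Context {R : realType}.
Implicit Types a b c : nat -> R.

(** For nonnegative terms this is summability; real partial sums keep extended reals out of the
    estimates. *)
Definition bounded_series a := exists M, forall n, series a n <= M.

Lemma nneseries_ltyP a : (forall n, 0 <= a n) ->
  (\sum_(0 <= n <oo) (a n)%:E < +oo)%E <-> bounded_series a.
Proof.
move=> a0; split=> [aoo|[M aM]].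
  exists (fine (\sum_(0 <= n <oo) (a n)%:E)%E) => n.
  have a0' : (0 <= \sum_(0 <= n <oo) (a n)%:E)%E.
    by apply: nneseries_ge0 => k _ _; rewrite lee_fin.
  rewrite -lee_fin fineK ?ge0_fin_numE//.
  apply: le_trans (nneseries_lim_ge n _); last by move=> k _ _; rewrite lee_fin.
  by rewrite -sumEFin.
apply: (@le_lt_trans _ _ M%:E); last exact: ltry.
apply: lime_le.
  by apply: is_cvg_nneseries => n _ _; rewrite lee_fin.
by near=> n; rewrite sumEFin lee_fin; exact: aM.
Unshelve. all: by end_near. Qed.

Lemma bounded_series_le a b : (forall n, a n <= b n) ->
  bounded_series b -> bounded_series a.
Proof.
move=> ab [M bM]; exists M => n; apply: le_trans (bM n).
by apply: ler_sum => i _; exact: ab.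
Qed.

Lemma bounded_seriesD a b : bounded_series a -> bounded_series b ->
  bounded_series (fun n => a n + b n).
Proof.
move=> [M aM] [N bN]; exists (M + N) => n.
by rewrite /series/= big_split/= lerD//; [exact: aM|exact: bN].
Qed.

Lemma bounded_seriesZ (k : R) a : 0 <= k -> bounded_series a ->
  bounded_series (fun n => k * a n).
Proof.
move=> k0 [M aM]; exists (k * M) => n.
by rewrite /series/= -mulr_sumr ler_wpM2l//; exact: aM.
Qed.

Lemma bounded_series_sum (I : finType) (F : I -> nat -> R) :
  (forall i, bounded_series (F i)) -> bounded_series (fun n => \sum_i F i n).
Proof.
move=> H; have [M FM] := choice H; exists (\sum_i M i) => n.
by rewrite /series/= exchange_big/= ler_sum// => i _; exact: FM.
Qed.

Section Nonnegative.
Context (a : nat -> R).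
Hypothesis a_ge0 : forall n, 0 <= a n.
Hypothesis a_bs : bounded_series a.

Lemma bounded_series_is_cvg : cvgn (series a).
Proof.
have [M aM] := a_bs; apply: nondecreasing_is_cvgn.
  by apply/nondecreasing_seqP => n; rewrite seriesSr lerDl.
by exists M => _ [n _ <-].
Qed.

Lemma bounded_series_cvg0 : a n @[n --> \oo] --> 0.
Proof. exact: cvg_series_cvg_0 bounded_series_is_cvg. Qed.

Lemma bounded_series_term : exists2 M, 0 <= M & forall n, a n <= M.
Proof.
have [M aM] := a_bs; exists M.
  by have := aM 0%N; rewrite /series/= big_geq.
move=> n; have := aM n.+1; rewrite seriesSr; apply: le_trans.
by rewrite lerDr; exact: sumr_ge0.
Qed.

Lemma bounded_seriesM b : (forall n, 0 <= b n) -> bounded_series b ->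
  bounded_series (fun n => a n * b n).
Proof.
move=> b0 bb; have [M M0 aM] := bounded_series_term.
apply: (@bounded_series_le _ (fun n => M * b n)); last exact: bounded_seriesZ.
by move=> n; rewrite ler_wpM2r.
Qed.

End Nonnegative.

Lemma bounded_series_sqr a : (forall n, 0 <= a n) -> bounded_series a ->
  bounded_series (fun n => a n ^+ 2).
Proof.
move=> a0 aa; under [X in bounded_series X]funext do rewrite expr2.
exact: bounded_seriesM.
Qed.

(* Deterministic Robbins-Siegmund: dividing by [\prod_(k < n) (1 + c k)], which
   increases to a finite limit, removes the multiplicative perturbation. *)
Section RobbinsSiegmund.
Context (E s e c : nat -> R).
Hypothesis E_ge0 : forall n, 0 <= E n.
Hypothesis s_ge0 : forall n, 0 <= s n.
Hypothesis e_ge0 : forall n, 0 <= e n.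
Hypothesis c_ge0 : forall n, 0 <= c n.
Hypothesis e_bs : bounded_series e.
Hypothesis c_bs : bounded_series c.
Hypothesis E_rec : forall n, E n.+1 <= (1 + c n) * (E n - s n + e n).

Let P n := \prod_(0 <= k < n) (1 + c k).

Let P_S n : P n.+1 = P n * (1 + c n).
Proof. by rewrite /P big_nat_recr. Qed.

Let P_ge1 n : 1 <= P n.
Proof.
elim: n => [|n IH]; first by rewrite /P big_geq.
by rewrite P_S mulr_ege1// lerDl.
Qed.

Let P_gt0 n : 0 < P n.
Proof. exact: lt_le_trans ltr01 _. Qed.

(** Since 1 + c k <= exp (c k), the product is at most the exponential of the partial sum. *)
Let P_bounded : exists M, forall n, P n <= M.
Proof.
have [M cM] := c_bs; exists (expR M) => n.
apply: (@le_trans _ _ (expR (series c n))); last by rewrite ler_expR.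
elim: n => [|n IH]; first by rewrite /P /series/= !big_geq// expR0.
rewrite P_S seriesSr expRD; apply: ler_pM => //.
- exact: ltW.
- by rewrite addr_ge0.
- exact: expR_ge1Dx.
Qed.

Let P_is_cvg : cvgn P.
Proof.
have [M PM] := P_bounded; apply: nondecreasing_is_cvgn; last by exists M => _ [n _ <-].
by apply/nondecreasing_seqP => n; rewrite P_S ler_peMr ?lerDl// ltW.
Qed.

Let F n := E n / P n.
Let S n := s n / P n.

Let F_S n : F n.+1 <= F n - S n + e n.
Proof.
rewrite /F ler_pdivrMr// (le_trans (E_rec n))// P_S mulrA mulrC ler_wpM2r//.
  by rewrite addr_ge0.
rewrite -ler_pdivrMr// mulrDl mulrBl lerD2l ler_pdivrMr//.
by rewrite ler_peMr.
Qed.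

Let F_ge0 n : 0 <= F n.
Proof. by rewrite divr_ge0// ltW. Qed.

Let S_ge0 n : 0 <= S n.
Proof. by rewrite divr_ge0// ltW. Qed.

(** The normalized energy, compensated for past decrease and past errors: it is nonincreasing and
    bounded below, hence convergent. *)
Let G n := F n + series S n - series e n.

Let G_S n : G n.+1 <= G n.
Proof. by rewrite /G !seriesSr; have := F_S n; lra. Qed.

Let series_ge0 (u : nat -> R) n : (forall n, 0 <= u n) -> 0 <= series u n.
Proof. by move=> u0; exact: sumr_ge0. Qed.

Let G_is_cvg : cvgn G.
Proof.
have [M eM] := e_bs; apply: nonincreasing_is_cvgn.
  by apply/nonincreasing_seqP.
exists (- M) => _ [n _ <-]; rewrite /G.
by have := eM n; have := F_ge0 n; have := series_ge0 n S_ge0; lra.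
Qed.

Let G_le n : G n <= F 0%N.
Proof.
elim: n => [|n]; last exact: le_trans (G_S n).
by rewrite /G /series/= !big_geq// addr0 subr0.
Qed.

Let S_bs : bounded_series S.
Proof.
have [M eM] := e_bs; exists (F 0%N + M) => n.
by have := G_le n; have := eM n; have := F_ge0 n; rewrite /G; lra.
Qed.

Lemma robbins_siegmund_summable : bounded_series s.
Proof.
have [M PM] := P_bounded; have M0 : 0 <= M by exact: le_trans (ltW (P_gt0 0)) (PM 0%N).
apply: bounded_series_le (bounded_seriesZ M0 S_bs) => n.
by rewrite /S mulrA ler_pdivlMr// mulrC ler_wpM2r.
Qed.

Lemma robbins_siegmund_cvg : cvgn E.
Proof.
have FG : F = (G \- series S) \+ series e.
  by apply/funext => n; rewrite /G /=; lra.
have cF : cvgn F.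
  rewrite FG; apply: is_cvgD; first apply: is_cvgB => //;
  exact: bounded_series_is_cvg.
have -> : E = F \* P by apply/funext => n; rewrite /F/= divfK// gt_eqF.
exact: is_cvgM.
Qed.

End RobbinsSiegmund.

End BoundedSeries.

(** * Weak limits *)

(** Allows the ultrafilter form of compactness to be applied to the scalar sequences ['[u n, y]]. *)
Lemma fmap_ultra (T T' : Type) (f : T -> T') (F : set_system T) :
  UltraFilter F -> UltraFilter (f @ F).
Proof.
move=> FU; split; first exact: fmap_proper_filter.
move=> G GF FG; apply/seteqP; split=> [A GA|A]; last exact: FG.
have [//|FnA] := in_ultra_setVsetC (f @^-1` A) FU.
have GnA : G (~` A) by apply: FG.
by have /filter_ex[? []] : G (A `&` ~` A) by exact: filterI.
Qed.

Section WeakLimits.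
Context {R : realType} {K : hilbertType R}.
Implicit Types (u v : nat -> K) (F : set_system nat) (l y : K).

(** The filter is arbitrary because cluster points are taken along filters finer than [\oo], in the
    role of subsequences. *)
Definition weak_lim F u l := forall y, '[u n, y] @[n --> F] --> '[l, y].

(** Weak compactness of balls: each ['[u n, y]] stays in a compact segment, so it converges along
    the ultrafilter. The limit is a bounded linear function of [y], represented by Riesz. *)
Lemma bounded_ultra_weak_lim F u (M : R) : UltraFilter F ->
  (forall n, `|u n| <= M) -> exists l, weak_lim F u l.
Proof.
move=> FU uM; have FF : ProperFilter F by exact: ultra_proper.
have inner_leM n y : `|'[u n, y]| <= M * `|y|.
  by rewrite (le_trans (inner_le _ _))// ler_wpM2r.
have cvgF y : cvg ('[u n, y] @[n --> F]).
  have := @segment_compact R (- (M * `|y|)) (M * `|y|); rewrite compact_ultra.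
  move=> /(_ _ (fmap_ultra (fun n => '[u n, y]) FU))[|l [_ ul]].
    rewrite /fmap/=; apply: filterE => n /=.
    by rewrite in_itv/= -ler_norml inner_leM.
  by apply/cvg_ex; exists l.
pose l y : R := lim ('[u n, y] @[n --> F]).
have ul y : '[u n, y] @[n --> F] --> l y by exact: cvgF.
have l_linear (a : R) x y : l (a *: x + y) = a * l x + l y.
  apply: cvg_lim => //.
  under eq_cvg do rewrite innerDr innerZr.
  by apply: cvgD => //; apply: cvgM => //; exact: cvg_cst.
have l_le y : `|l y| <= M * `|y|.
  have uly : `|'[u n, y]| @[n --> F] --> `|l y| by exact: cvg_norm.
  by apply: (cvgr_to_le uly); apply: nearW => n; exact: inner_leM.
have l_sub x y : l x - l y = l (x - y).
  symmetry; apply: cvg_lim => //.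
  by under eq_cvg do rewrite innerBr; exact: cvgB.
have M1 : 0 < M + 1 by rewrite ltr_wpDl// (le_trans _ (uM 0%N)).
have l_cont : continuous l.
  move=> x; apply/cvgrPdist_le => e e0; near=> y.
  rewrite l_sub (le_trans (l_le _))// (@le_trans _ _ ((M + 1) * `|x - y|))//.
    by rewrite ler_wpM2r// lerDl.
  rewrite -ler_pdivlMl//; near: y.
  by apply: cvgr_dist_le; rewrite // mulr_gt0 ?invr_gt0.
have [w lw] := riesz l_linear l_cont.
by exists w => y; rewrite innerC -lw.
Unshelve. all: by end_near. Qed.

Lemma norm_sqr_cvg0 (v : nat -> K) : `|v n| ^+ 2 @[n --> \oo] --> (0 : R) ->
  v n @[n --> \oo] --> (0 : K).
Proof.
move=> v0; apply/cvgrPdist_le => e e0; near=> n.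
rewrite sub0r normrN -(@ler_pXn2r _ 2)// ?nnegrE ?(ltW e0)//; near: n.
by move/cvgr_le : v0; apply; rewrite exprn_gt0.
Unshelve. all: by end_near. Qed.

Lemma weak_lim_inner F u v l y (M : R) : Filter F -> (forall n, `|u n| <= M) ->
  weak_lim F u l -> v n @[n --> F] --> y -> '[u n, v n] @[n --> F] --> '[l, y].
Proof.
move=> FF uM ul vy.
have -> : '[l, y] = '[l, y] + 0 by rewrite addr0.
have -> : (fun n => '[u n, v n]) = (fun n => '[u n, y] + '[u n, v n - y]).
  by apply/funext => n; rewrite -innerDr addrC subrK.
apply: cvgD; first exact: ul.
have M1 : 0 < M + 1 by rewrite ltr_wpDl// (le_trans _ (uM 0%N)).
apply/cvgrPdist_le => e e0; near=> n.
rewrite sub0r normrN (le_trans (inner_le _ _))//.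
rewrite (@le_trans _ _ ((M + 1) * `|v n - y|))//.
  by rewrite ler_wpM2r// (le_trans (uM n))// lerDl.
rewrite -ler_pdivlMl// distrC; near: n.
by move/cvgrPdist_le: vy; apply; rewrite mulr_gt0 ?invr_gt0.
Unshelve. all: by end_near. Qed.

Lemma weak_limD0 F u v l : Filter F -> weak_lim F u l -> v n @[n --> F] --> (0 : K) ->
  weak_lim F (fun n => u n + v n) l.
Proof.
move=> FF ul v0 y; rewrite -[l]addr0 innerDl; under eq_cvg do rewrite innerDl.
apply: cvgD; first exact: ul.
exact: (cvg_comp _ _ v0 (@inner_continuous _ _ y 0)).
Qed.

(** Were the limit [l] along one ultrafilter not the weak limit, an ultrafilter on the bad indices
    would give a cluster point other than [l]. The filter [F] is returned so that properties of
    cluster points apply to [l]. *)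
Lemma weak_cvg_of_unique u (M : R) : (forall n, `|u n| <= M) ->
  (forall F G l l', ProperFilter F -> ProperFilter G -> \oo `<=` F -> \oo `<=` G ->
    weak_lim F u l -> weak_lim G u l' -> l = l') ->
  exists F l, [/\ ProperFilter F, \oo `<=` F, weak_lim F u l & weak_cvg u l].
Proof.
move=> uM u_uniq.
have [F [FU oF]] := ultraFilterLemma (@eventually_filter).
have FF : ProperFilter F by exact: ultra_proper.
have [l ul] := bounded_ultra_weak_lim FU uM.
exists F, l; split=> // y; apply/cvgrPdist_le => e e0; apply: contrapT => nbad.
(* The bad indices meet every set of [\oo], so some ultrafilter finer than [\oo] contains them. *)
pose bad := [set n | ~ `|'[l, y] - '[u n, y]| <= e].
have wF : ProperFilter (within bad \oo).
  apply: Build_ProperFilter_ex.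
  move=> A; rewrite /within/= => oA; apply: contrapT => An; apply: nbad.
  apply: filterS oA => n nA; apply: contrapT => nb.
  by apply: An; exists n; exact: nA.
have [G [GU wG]] := ultraFilterLemma wF.
have GF : ProperFilter G by exact: ultra_proper.
have oG : \oo `<=` G.
  by move=> A oA; apply: wG; rewrite /within/=; apply: filterS oA.
have [l' ul'] := bounded_ultra_weak_lim GU uM.
have ll := u_uniq _ _ _ _ FF GF oF oG ul ul'; subst l'.
have Gbad : G bad by apply: wG; rewrite /within/=; exact: filterE.
have /cvgrPdist_le /(_ e e0) Ggood := ul' y.
by have /filter_ex[n []] : G (bad `&` [set n | `|'[l, y] - '[u n, y]| <= e])
  by exact: filterI.
Qed.

End WeakLimits.

(** * Strong convergence of almost decreasing operators *)

Section AlmostDecreasing.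
Context {R : realType} {K : hilbertType R}.
Context (alpha : R) (W : nat -> {linear K -> K}) (eta : nat -> R).
Hypothesis alpha_gt0 : 0 < alpha.
Hypothesis eta_ge0 : forall n, 0 <= eta n.
Hypothesis eta_bs : bounded_series eta.
Hypothesis W_sym : forall n x y, '[W n x, y] = '[x, W n y].
Hypothesis W_ge0 : forall n x, 0 <= '[W n x, x].
Hypothesis W_le : forall n x, '[W n x, x] <= alpha^-1 * `|x| ^+ 2.
Hypothesis W_mono : forall n x, '[W n.+1 x, x] <= (1 + eta n) * '[W n x, x].

(* [W n - alpha^-1 * series eta n] is a nonincreasing sequence of operators. *)
Lemma almost_decreasing_cvg u : exists w : K, W n u @[n --> \oo] --> w.
Proof.
have [M eM] := eta_bs.
pose sg n := series eta n.
have a0 : 0 <= alpha^-1 by rewrite invr_ge0 ltW.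
pose tau n (v : K) := '[W n v, v] - alpha^-1 * sg n * `|v| ^+ 2.
have tauS n v : tau n.+1 v <= tau n v.
  rewrite /tau /sg seriesSr.
  have := W_mono n v; have := ler_wpM2l (eta_ge0 n) (W_le n v); lra.
have tau_le n m v : (n <= m)%N -> tau m v <= tau n v.
  have /nonincreasing_seqP h : forall n, tau n.+1 v <= tau n v by move=> k; exact: tauS.
  by move=> nm; exact: h.
have sg_le n : sg n <= M by exact: eM.
have sg0 n : 0 <= sg n by exact: sumr_ge0.
have M0 : 0 <= M by exact: le_trans (sg0 0%N) (sg_le 0%N).
have tau_cvg : cvgn (tau ^~ u).
  apply: nonincreasing_is_cvgn; first by apply/nonincreasing_seqP => n; exact: tauS.
  exists (- (alpha^-1 * M * `|u| ^+ 2)) => _ [n _ <-].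
  rewrite /tau; have := W_ge0 n u.
  have : alpha^-1 * sg n * `|u| ^+ 2 <= alpha^-1 * M * `|u| ^+ 2.
    by rewrite ler_wpM2r ?sqr_ge0// ler_wpM2l.
  lra.
have [w0 tw] : exists w0 : K, (W n u - (alpha^-1 * sg n) *: u) @[n --> \oo] --> w0.
  apply: cauchy_seq_cvg => e e0.
  pose C := alpha^-1 * (1 + M) + 1.
  have C0 : 0 < C by rewrite ltr_wpDl// mulr_ge0// addr_ge0.
  have /cvg_ex[/= l taul] := tau_cvg.
  have tau_ge n : l <= tau n u.
    by move/cvgr_to_le : (taul); apply; near=> m; apply: tau_le; near: m; exact: nbhs_infty_ge.
  have [N _ Ntau] : \forall n \near \oo, tau n u <= l + C^-1 * e ^+ 2.
    move/cvgr_le : taul; apply.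
    by rewrite ltrDl mulr_gt0 ?invr_gt0 ?exprn_gt0.
  exists N => n Nn; rewrite -(@ler_pXn2r _ 2)// ?nnegrE ?(ltW e0)//.
  (* [Z] is the difference of the corrected operators at [N] and [n]. It is positive with form at
     most [C], so [psd_norm_sqr] bounds |Z u|^2 by C (tau N u - tau n u), and scalar convergence
     makes the vectors Cauchy. *)
  pose Z : {linear K -> K} :=
    (W N \- W n) \+ ((alpha^-1 * (sg n - sg N)) \*: idfun).
  have ZE v : Z v = W N v - W n v + (alpha^-1 * (sg n - sg N)) *: v by [].
  have Zsym v1 v2 : '[Z v1, v2] = '[v1, Z v2].
    by rewrite !ZE !(innerDl, innerDr, innerNl, innerNr, innerZl, innerZr) !W_sym.
  have Zform v : '[Z v, v] = tau N v - tau n v.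
    by rewrite ZE innerDl innerBl innerZl innerE /tau; ring.
  have Z0 v : 0 <= '[Z v, v] by rewrite Zform subr_ge0 tau_le.
  have ZC v : '[Z v, v] <= C * `|v| ^+ 2.
    rewrite ZE innerDl innerBl innerZl innerE.
    have h1 := W_le N v; have h2 := W_ge0 n v.
    have h3 : alpha^-1 * (sg n - sg N) * `|v| ^+ 2 <= alpha^-1 * M * `|v| ^+ 2.
      rewrite ler_wpM2r ?sqr_ge0// ler_wpM2l//.
      by have := sg_le n; have := sg0 N; lra.
    by have := sqr_ge0 `|v|; rewrite /C; lra.
  have := psd_norm_sqr Zsym Z0 ZC u; rewrite Zform.
  have -> : Z u = W N u - (alpha^-1 * sg N) *: u - (W n u - (alpha^-1 * sg n) *: u).
    by rewrite ZE; vector_ring.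
  move=> /le_trans; apply; rewrite -ler_pdivlMl//.
  by have := Ntau N (leqnn N); have := tau_ge n; lra.
have /cvg_ex[/= sl sgl] : cvgn sg by exact: bounded_series_is_cvg.
exists (w0 + (alpha^-1 * sl) *: u).
have -> : (fun n => W n u) =
    (fun n => (W n u - (alpha^-1 * sg n) *: u) + (alpha^-1 * sg n) *: u).
  by apply/funext => n; rewrite subrK.
apply: cvgD => //; apply: cvgZr_tmp; apply: cvgM => //; exact: cvg_cst.
Unshelve. all: by end_near. Qed.

End AlmostDecreasing.

(** * Error-tolerant forward-backward-forward splitting *)

Section ForwardBackwardForward.
Context {R : realType} {K : hilbertType R}.
Context (A : K -> set K) (B : K -> K) (beta : R).
Hypothesis A_monotone : forall x y u v, A x u -> A y v -> 0 <= '[x - y, u - v].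
Hypothesis A_resolvent : forall (t : R) x, 0 < t -> exists p, A p (t^-1 *: (x - p)).
Hypothesis beta_gt0 : 0 < beta.
Hypothesis B_monotone : forall x y, 0 <= '[x - y, B x - B y].
Hypothesis B_lipschitz : forall x y, `|B x - B y| <= beta * `|x - y|.

Context (alpha mu : R) (U W : nat -> {linear K -> K}) (eta : nat -> R).
Hypothesis alpha_gt0 : 0 < alpha.
Hypothesis mu_gt0 : 0 < mu.
Hypothesis eta_ge0 : forall n, 0 <= eta n.
Hypothesis eta_bs : bounded_series eta.
Hypothesis UK : forall n, cancel (U n) (W n).
Hypothesis W_sym : forall n x y, '[W n x, y] = '[x, W n y].
Hypothesis W_ge : forall n x, `|x| ^+ 2 <= mu * '[W n x, x].
Hypothesis W_le : forall n x, '[W n x, x] <= alpha^-1 * `|x| ^+ 2.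
Hypothesis W_mono : forall n x, '[W n.+1 x, x] <= (1 + eta n) * '[W n x, x].

Context (a b c : nat -> K).
Hypothesis a_bs : bounded_series (fun n => `|a n|).
Hypothesis b_bs : bounded_series (fun n => `|b n|).
Hypothesis c_bs : bounded_series (fun n => `|c n|).

Context (lambda : R) (gamma : nat -> R).
Hypothesis lambda_le : (lambda * mu * beta) ^+ 2 <= 10^-1.
Hypothesis gamma_itv : forall n, 0 < gamma n <= lambda.
Context (gamma0 : R).
Hypothesis gamma0_gt0 : 0 < gamma0.
Hypothesis gamma_ge : \forall n \near \oo, gamma0 <= gamma n.

Context (p_init : K) (x y p q : nat -> K).
Let P := lag p_init p.
Let pt n := p n - b n.
Hypothesis yE : forall n, y n = x n - gamma n *: U n (B (P n) + a n).
Hypothesis ptA : forall n, A (pt n) ((gamma n)^-1 *: W n (y n - pt n)).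
Hypothesis qE : forall n, q n = p n - gamma n *: U n (B (p n) + c n).
Hypothesis xE : forall n, x n.+1 = x n - y n + q n.

Let W_ge0 n u : 0 <= '[W n u, u].
Proof. by rewrite -(pmulr_rge0 _ mu_gt0) (le_trans _ (W_ge n u))// sqr_ge0. Qed.

Let U_norm n u : `|U n u| <= mu * `|u|.
Proof.
have [->|U0] := eqVneq (U n u) 0; first by rewrite normr0 mulr_ge0// ltW.
have Up : 0 < `|U n u| by rewrite normr_gt0.
rewrite -(ler_pM2r Up) -expr2 (le_trans (W_ge n _))// UK -mulrA ler_pM2l//.
exact: le_trans (ler_norm _) (inner_le _ _).
Qed.

Let U_form n u : '[W n (U n u), U n u] <= mu * `|u| ^+ 2.
Proof.
rewrite UK (le_trans (ler_norm _))// (le_trans (inner_le _ _))//.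
by rewrite expr2 mulrCA ler_wpM2l.
Qed.

Let gamma_gt0 n : 0 < gamma n.
Proof. by case/andP: (gamma_itv n). Qed.

Let gamma_le n : gamma n <= lambda.
Proof. by case/andP: (gamma_itv n). Qed.

(** Bounds the norm of every step operator [gamma n *: U n]; the step-size condition says that (t
    beta)^2 is at most 1/10. *)
Let t := lambda * mu.

Let t_gt0 : 0 < t.
Proof. by rewrite mulr_gt0// (lt_le_trans (gamma_gt0 0) (gamma_le 0)). Qed.

Let gU_norm n u : `|gamma n *: U n u| <= t * `|u|.
Proof.
rewrite normrZ gtr0_norm// -mulrA; apply: ler_pM => //; exact: ltW.
Qed.

Let gU_form n u : mu * '[W n (gamma n *: U n u), gamma n *: U n u] <= t ^+ 2 * `|u| ^+ 2.
Proof.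
rewrite [W n _]linearZ innerZl innerZr.
apply: (@le_trans _ _ (mu * (lambda * (lambda * (mu * `|u| ^+ 2))))); last first.
  by rewrite /t le_eqVlt; apply/orP; left; apply/eqP; ring.
have g0 := ltW (gamma_gt0 n); rewrite ler_pM2l//; apply: ler_pM; rewrite ?mulr_ge0 ?W_ge0//.
by apply: ler_pM; rewrite ?W_ge0 ?gamma_le ?U_form.
Qed.

(** With s = beta |u - v|, Young's inequality (s + r)^2 <= (3/2) s^2 + 3 r^2 holds because the
    difference of its sides is (s - 2 r)^2 / 2. The bound on (t beta)^2 then gives 3/20. *)
Let lip_sqr (u v w : K) (r : R) : 0 <= r -> `|w| <= beta * `|u - v| + r ->
  t ^+ 2 * `|w| ^+ 2 <= 3 / 20 * `|u - v| ^+ 2 + 3 * t ^+ 2 * r ^+ 2.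
Proof.
move=> r0 wle.
have tb : t ^+ 2 * beta ^+ 2 <= 10^-1 by rewrite -exprMn.
have : `|w| ^+ 2 <= (beta * `|u - v| + r) ^+ 2.
  by rewrite ler_pXn2r// nnegrE// addr_ge0// mulr_ge0// ltW.
rewrite -(ler_pM2l (exprn_gt0 2 t_gt0)) => /le_trans; apply.
set d := `|u - v|.
have h1 : t ^+ 2 * beta ^+ 2 * d ^+ 2 <= 10^-1 * d ^+ 2 by rewrite ler_wpM2r// sqr_ge0.
have h2 : 0 <= t ^+ 2 * (beta * d - 2 * r) ^+ 2 by rewrite mulr_ge0 ?sqr_ge0.
lra.
Qed.

Let D n := `|pt n - P n| ^+ 2.
Let S n := `|pt n - x n| ^+ 2.
Let T n := `|x n - P n| ^+ 2.
Let e0 n := `|a n| + `|b n| + `|c n|.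

Let e0_ge0 n : 0 <= e0 n.
Proof. by rewrite !addr_ge0. Qed.

Let e0_bs : bounded_series e0.
Proof. by apply: bounded_seriesD => //; exact: bounded_seriesD. Qed.

Let xS n : x n.+1 = p n + gamma n *: U n (B (P n) - B (p n) + a n - c n).
Proof.
by rewrite xE yE qE !(linearB, linearD)/=; vector_ring.
Qed.

(** Up to errors, [x n.+1 - p n] is the step operator applied to the increment of [B] between [P n]
    and [p n], so reusing the old evaluation costs only a multiple of [D n]. *)
Let T_rec n : T n.+1 <= 3 / 20 * D n + 3 * t ^+ 2 * ((1 + beta) * e0 n) ^+ 2.
Proof.
rewrite /T /P /= xS addrAC subrr add0r.
rewrite (@le_trans _ _ (t ^+ 2 * `|B (P n) - B (p n) + a n - c n| ^+ 2))//.
  by rewrite -exprMn ler_pXn2r ?nnegrE// mulr_ge0// ltW.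
rewrite /D (distrC (pt n)); apply: lip_sqr.
  by rewrite mulr_ge0// addr_ge0// ltW.
have -> : p n = pt n + b n by rewrite subrK.
have := B_lipschitz (P n) (pt n + b n).
rewrite opprD addrA => h1.
have h2 := ler_normB (P n - pt n) (b n).
have h3 := ler_normB (B (P n) - B (pt n + b n) + a n) (c n).
have h4 := ler_normD (B (P n) - B (pt n + b n)) (a n).
have h5 : beta * `|P n - pt n - b n| <= beta * (`|P n - pt n| + `|b n|) by rewrite ler_pM2l.
have b0 := ltW beta_gt0.
have := mulr_ge0 b0 (normr_ge0 (a n)); have := mulr_ge0 b0 (normr_ge0 (c n)).
rewrite /e0; have := normr_ge0 (b n); lra.
Qed.

Let D_le n : D n <= 2 * S n + 2 * T n.
Proof.
rewrite /D; have -> : pt n - P n = (pt n - x n) + (x n - P n) by rewrite addrA subrK.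
apply: (@le_trans _ _ ((`|pt n - x n| + `|x n - P n|) ^+ 2)).
  by rewrite ler_pXn2r ?nnegrE ?addr_ge0// ler_normD.
rewrite /S /T; have := sqr_ge0 (`|pt n - x n| - `|x n - P n|); lra.
Qed.

Section Zero.
Context (z : K).
Hypothesis z_zero : A z (- B z).

Let V n := '[W n (x n - z), x n - z].

Let g n := B (P n) - B (pt n) + a n.

(** The value of [x n.+1] if [b n] and [c n] were zero. The error [a n] stays, since [pt n] is the
    resolvent point of the perturbed [y n]. *)
Let xt n := pt n + gamma n *: U n (g n).

Let Vt n := '[W n (xt n - z), xt n - z].

(** Both squared distances are expanded around [pt n]. The cross terms have a good sign by [key],
    leaving the squared length of the correction [gamma n *: U n (g n)] minus that of
    [x n - pt n]. *)
Let Vt_le n : mu * Vt n <= mu * V n - S n + 3 / 20 * D n + 3 * t ^+ 2 * e0 n ^+ 2.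
Proof.
have W_linear := linearP (W n).
(* Monotonicity of [A] and of [B] between [pt n] and the zero [z], added up. *)
have key : gamma n * '[pt n - z, g n] <= '[pt n - z, W n (x n - pt n)].
  have := addr_ge0 (A_monotone (ptA n) z_zero) (B_monotone (pt n) z).
  have gn0 : gamma n != 0 by rewrite gt_eqF.
  rewrite -innerDr.
  suff -> : (gamma n)^-1 *: W n (y n - pt n) - - B z + (B (pt n) - B z) =
      (gamma n)^-1 *: (W n (x n - pt n) - gamma n *: g n).
    by rewrite innerZr pmulr_rge0 ?invr_gt0// innerBr innerZr subr_ge0.
  have -> : y n - pt n = (x n - pt n) - gamma n *: U n (B (P n) + a n).
    by rewrite yE addrAC.
  rewrite [W n (_ - gamma n *: _)]linearB linearZ/= UK.
  by apply: inner_ext => w; rewrite !(innerDl, innerNl, innerZl); field; rewrite gn0.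
have -> : Vt n = V n - '[W n (x n - pt n), x n - pt n] +
    '[W n (gamma n *: U n (g n)), gamma n *: U n (g n)] +
    2 * (gamma n * '[pt n - z, g n] - '[pt n - z, W n (x n - pt n)]).
  rewrite /Vt /V /xt.
  have -> : x n - z = (pt n - z) + (x n - pt n) by vector_ring.
  have -> : pt n + gamma n *: U n (g n) - z = (pt n - z) + gamma n *: U n (g n).
    by vector_ring.
  rewrite !(sym_form_sqrD (W_sym n)) (W_sym n (pt n - z) (gamma n *: _)).
  rewrite (W_sym n (pt n - z) (x n - pt n)) [W n (gamma n *: U n (g n))]linearZ/=.
  by rewrite UK innerZr; ring.
have h1 := W_ge n (x n - pt n).
have h2 := gU_form n (g n).
have h3 : t ^+ 2 * `|g n| ^+ 2 <= 3 / 20 * D n + 3 * t ^+ 2 * e0 n ^+ 2.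
  rewrite /D (distrC (pt n)); apply: lip_sqr => //.
  rewrite (le_trans (ler_normD _ _))// lerD ?B_lipschitz//.
  by rewrite /e0 -addrA lerDl addr_ge0.
rewrite /S (distrC (pt n)).
have h4 : mu * (gamma n * '[pt n - z, g n] - '[pt n - z, W n (x n - pt n)]) <= 0.
  by rewrite pmulr_rle0// subr_le0.
lra.
Qed.

Let Vt_ge0 n : 0 <= Vt n.
Proof. exact: W_ge0. Qed.

(** The square root passes from the norm to the metric [W n]; the other factor bounds |x n.+1 - xt
    n| in terms of [e0 n]. *)
Let k := Num.sqrt alpha^-1 * (1 + t * (beta + 1)).

Let k_ge0 : 0 <= k.
Proof. by rewrite mulr_ge0 ?sqrtr_ge0// addr_ge0// mulr_ge0 ?addr_ge0// ltW. Qed.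

Let eps n := k * e0 n.

Let eps_ge0 n : 0 <= eps n.
Proof. by rewrite mulr_ge0. Qed.

Let x_xt n : '[W n (x n.+1 - xt n), x n.+1 - xt n] <= eps n ^+ 2.
Proof.
rewrite (le_trans (W_le _ _))// /eps /k -mulrA exprMn sqr_sqrtr; last first.
  by rewrite invr_ge0 ltW.
rewrite ler_pM2l ?invr_gt0// ler_pXn2r ?nnegrE//; last first.
  by rewrite mulr_ge0// addr_ge0// mulr_ge0 ?addr_ge0// ltW.
have -> : x n.+1 - xt n = b n + gamma n *: U n (B (pt n) - B (p n) - c n).
  rewrite xS /xt /g !(linearB, linearD)/=.
  by have -> : p n = pt n + b n; [rewrite subrK | vector_ring].
rewrite (le_trans (ler_normD _ _))//.
have h1 := gU_norm n (B (pt n) - B (p n) - c n).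
have h2 := ler_normB (B (pt n) - B (p n)) (c n).
have h3 := B_lipschitz (pt n) (p n).
have h4 : `|pt n - p n| = `|b n| by rewrite /pt addrAC subrr add0r normrN.
rewrite h4 in h3.
have h5 : `|B (pt n) - B (p n) - c n| <= beta * `|b n| + `|c n| by lra.
have h6 : t * `|B (pt n) - B (p n) - c n| <= t * (beta * `|b n| + `|c n|).
  by rewrite ler_pM2l.
have b0 := ltW beta_gt0; have t0 := ltW t_gt0.
have m1 := mulr_ge0 (mulr_ge0 t0 b0) (normr_ge0 (a n)).
have m2 := mulr_ge0 (mulr_ge0 t0 b0) (normr_ge0 (c n)).
have m3 := mulr_ge0 t0 (normr_ge0 (a n)).
have m4 := mulr_ge0 t0 (normr_ge0 (b n)).
have := normr_ge0 (a n); have := normr_ge0 (c n); rewrite /e0; lra.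
Qed.

(** The cross term is at most 2 eps sqrt(Vt) <= eps (1 + Vt), proved after squaring by 4 Vt <= (1 +
    Vt)^2. This is the source of the factor 1 + eps n. *)
Let V_step n : '[W n (x n.+1 - z), x n.+1 - z] <= (1 + eps n) * Vt n + eps n + eps n ^+ 2.
Proof.
have -> : x n.+1 - z = (xt n - z) + (x n.+1 - xt n) by vector_ring.
rewrite (sym_form_sqrD (W_sym n)) -/(Vt n).
have h1 := psd_inner_sqr (W_sym n) (W_ge0 n) (xt n - z) (x n.+1 - xt n).
have h2 : 2 * '[W n (xt n - z), x n.+1 - xt n] <= eps n * (1 + Vt n).
  rewrite (le_trans (ler_norm _))// -(@ler_pXn2r _ 2)// ?nnegrE//; last first.
    by rewrite mulr_ge0// addr_ge0.
  rewrite -normrX ger0_norm ?sqr_ge0//.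
  apply: (@le_trans _ _ (4 * (Vt n * eps n ^+ 2))).
    rewrite exprMn -natrX ler_pM2l//; apply: (le_trans h1).
    by rewrite ler_wpM2l.
  have : 0 <= eps n ^+ 2 * (1 - Vt n) ^+ 2 by rewrite mulr_ge0 ?sqr_ge0.
  lra.
have := x_xt n; lra.
Qed.

Let E n := V n + (2 * mu)^-1 * T n.
Let s n := mu^-1 * (2^-1 * S n + 40^-1 * D n).
Let e n := mu^-1 * (3 * t ^+ 2 * e0 n ^+ 2 + 2^-1 * (3 * t ^+ 2 * ((1 + beta) * e0 n) ^+ 2))
  + (eps n + eps n ^+ 2).
Let d n := eta n + eps n + eta n * eps n.

Let E_rec n : E n.+1 <= (1 + d n) * (E n - s n + e n).
Proof.
have mu0 : mu != 0 by rewrite gt_eqF.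
have T0 m : 0 <= T m by exact: sqr_ge0.
have h1 : Vt n + (2 * mu)^-1 * T n.+1 + eps n + eps n ^+ 2 <= E n - s n + e n.
  rewrite -(ler_pM2l mu_gt0).
  have -> : mu * (Vt n + (2 * mu)^-1 * T n.+1 + eps n + eps n ^+ 2) =
    mu * Vt n + 2^-1 * T n.+1 + mu * (eps n + eps n ^+ 2) by field.
  have -> : mu * (E n - s n + e n) = mu * V n + 2^-1 * T n - (2^-1 * S n + 40^-1 * D n)
    + (3 * t ^+ 2 * e0 n ^+ 2 + 2^-1 * (3 * t ^+ 2 * ((1 + beta) * e0 n) ^+ 2))
    + mu * (eps n + eps n ^+ 2) by rewrite /E /s /e; field.
  (* The sum of [Vt_le], one half of [T_rec] and one quarter of [D_le]. *)
  have := Vt_le n; have := T_rec n; have := D_le n.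
  lra.
have h2 := W_mono n (x n.+1 - z).
have h3 := V_step n.
have e1 : 0 <= eta n by [].
have h4 : V n.+1 <= (1 + eta n) * ((1 + eps n) * Vt n + eps n + eps n ^+ 2).
  by rewrite (le_trans h2)// ler_wpM2l// addr_ge0.
have -> : 1 + d n = (1 + eta n) * (1 + eps n) by rewrite /d; ring.
have ee : 0 <= 1 + eta n by rewrite addr_ge0.
have ep : 0 <= 1 + eps n by rewrite addr_ge0.
apply: (@le_trans _ _ ((1 + eta n) * (1 + eps n) *
    (Vt n + (2 * mu)^-1 * T n.+1 + eps n + eps n ^+ 2))); last first.
  by rewrite ler_wpM2l// mulr_ge0.
rewrite {1}/E; set T' := (2 * mu)^-1 * T n.+1.
have T'0 : 0 <= T' by rewrite mulr_ge0// invr_ge0 mulr_ge0// ltW.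
apply: (@le_trans _ _ ((1 + eta n) * ((1 + eps n) * Vt n + eps n + eps n ^+ 2 + T'))).
  rewrite mulrDr lerD// ler_peMl// lerDl//.
rewrite -mulrA ler_wpM2l//.
have := mulr_ge0 (eps_ge0 n) T'0; have := mulr_ge0 (eps_ge0 n) (eps_ge0 n).
have := mulr_ge0 (eps_ge0 n) (mulr_ge0 (eps_ge0 n) (eps_ge0 n)); lra.
Qed.

Let E_ge0 n : 0 <= E n.
Proof.
rewrite addr_ge0 ?W_ge0// mulr_ge0 ?sqr_ge0// invr_ge0 mulr_ge0//.
exact: ltW.
Qed.

Let s_ge0 n : 0 <= s n.
Proof.
by rewrite mulr_ge0 ?invr_ge0 ?(ltW mu_gt0)// addr_ge0// mulr_ge0 ?sqr_ge0// invr_ge0.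
Qed.

Let e_ge0 n : 0 <= e n.
Proof.
have t2 : 0 <= 3 * t ^+ 2 by rewrite mulr_ge0 ?sqr_ge0.
have t3 r : 0 <= 3 * t ^+ 2 * r ^+ 2 by rewrite mulr_ge0 ?sqr_ge0.
apply: addr_ge0; last by rewrite addr_ge0 ?eps_ge0 ?sqr_ge0.
apply: mulr_ge0; first by rewrite invr_ge0 ltW.
by apply: addr_ge0 => //; apply: mulr_ge0; rewrite ?invr_ge0.
Qed.

Let d_ge0 n : 0 <= d n.
Proof.
by apply: addr_ge0; [apply: addr_ge0 | apply: mulr_ge0]; rewrite ?eps_ge0 ?eta_ge0.
Qed.

Let eps_bs : bounded_series eps.
Proof. exact: bounded_seriesZ. Qed.

Let e_bs : bounded_series e.
Proof.
have e2 := bounded_series_sqr e0_ge0 e0_bs.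
have t2 : 0 <= 3 * t ^+ 2 by rewrite mulr_ge0 ?sqr_ge0.
apply: bounded_seriesD.
  apply: bounded_seriesZ; first by rewrite invr_ge0 ltW.
  apply: bounded_seriesD; first exact: bounded_seriesZ.
  apply: bounded_seriesZ; first by rewrite invr_ge0.
  apply: bounded_seriesZ => //.
  apply: bounded_series_sqr; last apply: bounded_seriesZ => //.
    by move=> n; rewrite mulr_ge0// addr_ge0// ltW.
  by rewrite addr_ge0// ltW.
by apply: bounded_seriesD => //; exact: bounded_series_sqr.
Qed.

Let d_bs : bounded_series d.
Proof.
apply: bounded_seriesD; first exact: bounded_seriesD.
exact: bounded_seriesM.
Qed.

Let s_bs : bounded_series s.
Proof. exact: (robbins_siegmund_summable E_ge0 s_ge0 e_ge0 d_ge0 e_bs d_bs E_rec). Qed.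

Let E_cvg : cvgn E.
Proof. exact: (robbins_siegmund_cvg E_ge0 s_ge0 e_ge0 d_ge0 e_bs d_bs E_rec). Qed.

Lemma fbf_summable_prox_sub : bounded_series (fun n => `|pt n - x n| ^+ 2).
Proof.
have m0 : 0 <= 2 * mu by rewrite mulr_ge0// ltW.
apply: bounded_series_le (bounded_seriesZ m0 s_bs) => n; rewrite -/(S n) /s.
have -> : 2 * mu * (mu^-1 * (2^-1 * S n + 40^-1 * D n)) = S n + 20^-1 * D n.
  by field; rewrite gt_eqF.
by rewrite lerDl mulr_ge0 ?sqr_ge0// invr_ge0.
Qed.

Lemma fbf_summable_prox_lag : bounded_series (fun n => `|pt n - P n| ^+ 2).
Proof.
have m0 : 0 <= 40 * mu by rewrite mulr_ge0// ltW.
apply: bounded_series_le (bounded_seriesZ m0 s_bs) => n; rewrite -/(D n) /s.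
have -> : 40 * mu * (mu^-1 * (2^-1 * S n + 40^-1 * D n)) = 20 * S n + D n.
  by field; rewrite gt_eqF.
by rewrite lerDr mulr_ge0 ?sqr_ge0.
Qed.

(** The energy [E] converges, and its [T] part tends to 0 because [T_rec] bounds it by summable
    terms. *)
Lemma fbf_fejer_cvg : cvgn (fun n => '[W n (x n - z), x n - z]).
Proof.
have T_cvg : T n @[n --> \oo] --> 0.
  rewrite -cvg_shiftS.
  apply: (@squeeze_cvgr _ _ _ _ (fun=> 0)
    (fun n => 3 / 20 * D n + 3 * t ^+ 2 * ((1 + beta) * e0 n) ^+ 2)).
  - by apply: nearW => n; rewrite sqr_ge0 T_rec.
  - exact: cvg_cst.
  apply: bounded_series_cvg0.
    by move=> n; rewrite addr_ge0// mulr_ge0 ?sqr_ge0// mulr_ge0 ?sqr_ge0.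
  have b0 : 0 <= 1 + beta by rewrite addr_ge0// ltW.
  apply: bounded_seriesD; apply: bounded_seriesZ => //.
  - exact: fbf_summable_prox_lag.
  - by rewrite mulr_ge0 ?sqr_ge0.
  apply: bounded_series_sqr; last exact: bounded_seriesZ.
  by move=> n; rewrite mulr_ge0.
have -> : (fun n => '[W n (x n - z), x n - z]) = E \- (fun n => (2 * mu)^-1 * T n).
  by apply/funext => n; rewrite /E /V/= addrK.
apply: is_cvgB => //; apply: is_cvgM; first exact: is_cvg_cst.
by apply/cvg_ex; exists 0.
Qed.

Lemma fbf_bounded : exists M, forall n, `|x n| <= M.
Proof.
have [M [_ VM]] := cvg_seq_bounded fbf_fejer_cvg.
have {}VM n : V n <= M + 1.
  by rewrite (le_trans (ler_norm _))//; apply: VM => //; rewrite ltrDl.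
have M0 : 0 <= M + 1 by exact: le_trans (W_ge0 0 _) (VM 0%N).
exists (`|z| + Num.sqrt (mu * (M + 1))) => n.
have -> : x n = z + (x n - z) by rewrite addrC subrK.
rewrite (le_trans (ler_normD _ _))// lerD2l.
rewrite -(@ler_pXn2r _ 2)// ?nnegrE ?sqrtr_ge0// sqr_sqrtr; last first.
  by rewrite mulr_ge0// ltW.
by rewrite (le_trans (W_ge n _))// ler_pM2l//; exact: VM.
Qed.

End Zero.

Section Convergence.
Context (z : K).
Hypothesis z_zero : A z (- B z).

Let pt_x : pt n - x n @[n --> \oo] --> (0 : K).
Proof.
apply: norm_sqr_cvg0; apply: bounded_series_cvg0 (fbf_summable_prox_sub z_zero) => n.
exact: sqr_ge0.
Qed.

Let pt_P : pt n - P n @[n --> \oo] --> (0 : K).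
Proof.
apply: norm_sqr_cvg0; apply: bounded_series_cvg0 (fbf_summable_prox_lag z_zero) => n.
exact: sqr_ge0.
Qed.

(** By [ptA], an element of (A + B) (pt n). It tends to 0 in norm, which is where the lower bound on
    [gamma] enters. *)
Let res n := (gamma n)^-1 *: W n (y n - pt n) + B (pt n).

Let res_cvg0 : res n @[n --> \oo] --> (0 : K).
Proof.
apply/norm_cvg0P.
apply: (@squeeze_cvgr _ _ _ _ (fun=> 0) (fun n => gamma0^-1 * alpha^-1 * `|pt n - x n|
    + beta * `|pt n - P n| + `|a n|)).
- near=> n; rewrite normr_ge0/=.
  have gn0 : gamma n != 0 by rewrite gt_eqF.
  have -> : res n = - ((gamma n)^-1 *: W n (pt n - x n)) + (B (pt n) - B (P n)) - a n.
    rewrite /res yE !(linearB, linearD, linearZ)/= !UK.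
    by apply: inner_ext => w; rewrite !(innerDl, innerNl, innerZl); field; rewrite gn0.
  rewrite (le_trans (ler_normB _ _))// lerD2r (le_trans (ler_normD _ _))// lerD//.
  rewrite normrN normrZ -mulrA; apply: ler_pM => //.
    rewrite ger0_norm ?invr_ge0 ?(ltW (gamma_gt0 n))// lef_pV2 ?posrE//.
    by near: n.
  apply: (psd_bounded (W_sym n) (c := mu^-1)) (W_le n) _; rewrite ?invr_gt0// => v.
  by rewrite ler_pdivrMl.
- exact: cvg_cst.
- have -> : 0 = gamma0^-1 * alpha^-1 * 0 + beta * 0 + 0 :> R by rewrite !mulr0 !addr0.
  apply: cvgD; first apply: cvgD.
  + by apply: cvgM; [exact: cvg_cst | exact/norm_cvg0P].
  + by apply: cvgM; [exact: cvg_cst | exact/norm_cvg0P].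
  + exact: bounded_series_cvg0.
Unshelve. all: by end_near. Qed.

Let pt_bounded : exists M, forall n, `|pt n| <= M.
Proof.
have [M xM] := fbf_bounded z_zero.
have [N N0 SN] := bounded_series_term (fun n => sqr_ge0 `|pt n - x n|)
  (fbf_summable_prox_sub z_zero).
exists (M + (N + 1)) => n.
have -> : pt n = x n + (pt n - x n) by rewrite addrC subrK.
rewrite (le_trans (ler_normD _ _))// lerD//.
have := SN n; have := sqr_ge0 (`|pt n - x n| - 1); lra.
Qed.

(* The resolvent point of [l - tau B l] plays the role of a Minty test point: no
   maximality of [A + B] is needed. *)
Let weak_cluster_zero (F : set_system nat) l : ProperFilter F -> \oo `<=` F ->
  weak_lim F x l -> A l (- B l).
Proof.
move=> FF oF xl.
(* With this step the resolvent contributes 2 beta |l - q'|^2, twice what the Lipschitz bound on [B]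
   can take back. This forces q' = l, and then w = - B l. *)
have t0 : 0 < (2 * beta)^-1 by rewrite invr_gt0 mulr_gt0.
have [q' Aq] := A_resolvent (l - (2 * beta)^-1 *: B l) t0.
rewrite invrK in Aq; set w := _ *: _ in Aq.
have ptl : weak_lim F pt l.
  have -> : pt = (fun n => x n + (pt n - x n)) by apply/funext => n; rewrite addrC subrK.
  by apply: weak_limD0 => //; exact: cvg_trans (cvg_app _ oF) pt_x.
have [M ptM] := pt_bounded.
have lim1 : '[pt n, res n] - '[q', res n] - '[pt n, w + B q'] + '[q', w + B q'] @[n --> F]
    --> '[l, 0] - '[q', 0] - '[l, w + B q'] + '[q', w + B q'].
  have resF : res n @[n --> F] --> (0 : K) by exact: cvg_trans (cvg_app _ oF) res_cvg0.
  apply: cvgD; last exact: cvg_cst.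
  apply: cvgB; last exact: ptl.
  apply: cvgB; first exact: weak_lim_inner ptM ptl resF.
  by apply: inner_cvg => //; exact: cvg_cst.
have lim_ge0 : 0 <= '[l, 0] - '[q', 0] - '[l, w + B q'] + '[q', w + B q'].
  apply: (cvgr_to_ge lim1); apply: nearW => n.
  have := addr_ge0 (A_monotone (ptA n) Aq) (B_monotone (pt n) q').
  rewrite -innerDr.
  have -> : (gamma n)^-1 *: W n (y n - pt n) - w + (B (pt n) - B q') =
    res n - (w + B q') by rewrite /res; vector_ring.
  by rewrite !(innerBl, innerBr); lra.
have h1 := B_lipschitz l q'.
have wE : w = (2 * beta) *: (l - q') - B l.
  have b0 : beta != 0 by rewrite gt_eqF.
  rewrite /w; apply: inner_ext => v; rewrite !(innerDl, innerNl, innerZl).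
  by field; rewrite b0.
have h2 : '[l - q', B l - B q'] <= beta * `|l - q'| ^+ 2.
  rewrite (le_trans (ler_norm _))// (le_trans (inner_le _ _))//.
  by rewrite expr2 mulrCA ler_wpM2l.
have h3 : '[l - q', w + B q'] = 2 * beta * `|l - q'| ^+ 2 - '[l - q', B l - B q'].
  by rewrite wE -innerE -innerZr -innerBr; congr '[_, _]; vector_ring.
move: lim_ge0; rewrite !inner0r => lim_ge0.
have h4 : '[l - q', w + B q'] <= 0 by rewrite innerBl; lra.
have h5 : `|l - q'| ^+ 2 <= 0.
  by rewrite -(pmulr_rle0 _ beta_gt0); lra.
have lq : l = q'.
  by apply/eqP; rewrite -subr_eq0 -normr_eq0 -sqrf_eq0 eq_le h5 sqr_ge0.
by move: Aq; rewrite wE -lq subrr scaler0 sub0r.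
Qed.

(** With d = l - l', the distances to the two zeros differ by 2 <x n - l, W n d> + <W n d, d>, which
    converges. If w is the limit of W n d, comparing the limits along [F] and [G] gives <d, w> = 0,
    and coercivity of [W n] forces d = 0. *)
Let weak_cluster_unique (F G : set_system nat) l l' : ProperFilter F -> ProperFilter G ->
  \oo `<=` F -> \oo `<=` G -> weak_lim F x l -> weak_lim G x l' -> l = l'.
Proof.
move=> FF GF oF oG xl xl'.
have zl := weak_cluster_zero FF oF xl; have zl' := weak_cluster_zero GF oG xl'.
have [M xM] := fbf_bounded z_zero.
set d := l - l'.
have [w Ww] := almost_decreasing_cvg alpha_gt0 eta_ge0 eta_bs W_sym W_ge0 W_le W_mono d.
have /cvg_ex[/= v vl] := fbf_fejer_cvg zl.
have /cvg_ex[/= v' vl'] := fbf_fejer_cvg zl'.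
have quad : '[W n d, d] @[n --> \oo] --> '[w, d].
  by apply: inner_cvg => //; exact: cvg_cst.
have key : '[x n, W n d] - '[l, W n d] @[n --> \oo] --> 2^-1 * (v' - v - '[w, d]).
  have -> : (fun n => '[x n, W n d] - '[l, W n d]) =
    (fun n => 2^-1 * ('[W n (x n - l'), x n - l'] - '[W n (x n - l), x n - l]
      - '[W n d, d])).
    apply/funext => n; have -> : x n - l' = (x n - l) + d by rewrite addrA subrK.
    by rewrite (sym_form_sqrD (W_sym n)) (W_sym n (x n - l) d) [in RHS](innerBl _ _ (W n d)); field.
  by apply: cvgM; [exact: cvg_cst | apply: cvgB => //; exact: cvgB].
have WwF : W n d @[n --> F] --> w by exact: cvg_trans (cvg_app _ oF) Ww.
have WwG : W n d @[n --> G] --> w by exact: cvg_trans (cvg_app _ oG) Ww.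
have limF : '[x n, W n d] - '[l, W n d] @[n --> F] --> '[l, w] - '[l, w].
  apply: cvgB; first exact: weak_lim_inner xM xl WwF.
  by apply: inner_cvg => //; exact: cvg_cst.
have limG : '[x n, W n d] - '[l, W n d] @[n --> G] --> '[l', w] - '[l, w].
  apply: cvgB; first exact: weak_lim_inner xM xl' WwG.
  by apply: inner_cvg => //; exact: cvg_cst.
have keyF := cvg_trans (cvg_app _ oF) key.
have keyG := cvg_trans (cvg_app _ oG) key.
have limE : '[l', w] - '[l, w] = '[l, w] - '[l, w] :> R.
  by rewrite (cvg_unique (@norm_hausdorff _ _) limG keyG)
    (cvg_unique (@norm_hausdorff _ _) limF keyF).
have dw : '[w, d] = 0 by rewrite innerC /d innerBl; move: limE; lra.
have d0 : `|d| ^+ 2 <= 0.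
  rewrite -[leRHS](mulr0 mu) -dw.
  have muq : mu * '[W n d, d] @[n --> \oo] --> mu * '[w, d].
    by apply: cvgM => //; exact: cvg_cst.
  by apply: (cvgr_to_ge muq); apply: nearW => n; exact: W_ge.
by apply/eqP; rewrite -subr_eq0 -normr_eq0 -sqrf_eq0 eq_le d0 sqr_ge0.
Qed.

Theorem fbf_cvg : bounded_series (fun n => `|x n - p n| ^+ 2) /\
  exists l, [/\ A l (- B l), weak_cvg x l & weak_cvg p l].
Proof.
split.
  have b2 := bounded_series_sqr (fun n => normr_ge0 (b n)) b_bs.
  apply: (@bounded_series_le _ _ (fun n => 2 * `|pt n - x n| ^+ 2 + 2 * `|b n| ^+ 2)).
    move=> n; have -> : x n - p n = - ((pt n - x n) + b n) by vector_ring.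
    rewrite normrN (@le_trans _ _ ((`|pt n - x n| + `|b n|) ^+ 2))//.
      by rewrite ler_pXn2r ?nnegrE ?addr_ge0// ler_normD.
    by have := sqr_ge0 (`|pt n - x n| - `|b n|); lra.
  by apply: bounded_seriesD; apply: bounded_seriesZ => //; exact: fbf_summable_prox_sub z_zero.
have [M xM] := fbf_bounded z_zero.
have [F [l [FF oF xl wl]]] := weak_cvg_of_unique xM weak_cluster_unique.
exists l; split=> //; first exact: weak_cluster_zero xl.
have -> : p = (fun n => x n + (pt n - x n + b n)) by apply/funext => n; vector_ring.
apply: weak_limD0 => //; rewrite -[0]addr0; apply: cvgD => //.
by apply/norm_cvg0P; exact: bounded_series_cvg0.
Qed.

End Convergence.

End ForwardBackwardForward.

(** * Gradients of convex functions *)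

Section Gradient.
Context {R : realType} {H : hilbertType R} (h : H -> R^o).
Hypothesis h_convex : convex_function [set: convex_lmodType H] h.
Hypothesis h_diff : forall x, differentiable h x.
Implicit Types x y d : H.

Lemma gradP x d : 'd h x d = '[d, grad h x] :> R.
Proof.
have dc : continuous ('d h x) by exact: diff_continuous.
have [|u hu] := @riesz R H ('d h x) _ dc; first by move=> a y z; rewrite linearP.
move: d; exact: (xgetPex (0 : H) (ex_intro (fun u => forall d, 'd h x d = '[d, u]) u hu)).
Qed.

Lemma convex_fun x y (t : R) : 0 < t < 1 ->
  h (t *: y + (1 - t) *: x) <= t * h y + (1 - t) * h x.
Proof.
move=> /andP[t0 t1].
have := h_convex (Itv01 (ltW t0) (ltW t1)) (in_setT y) (in_setT x).
by [].
Qed.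

(** By convexity the difference quotients along y - x are at most h y - h x for 0 < t < 1; their
    limit from the right is the derivative. *)
Lemma grad_ineq x y : h x + '[y - x, grad h x] <= h y.
Proof.
rewrite -gradP -(deriveE _ (h_diff x)) -lerBrDl.
have /cvg_dnbhs_at_right hd := @diff_derivable _ _ _ h x (y - x) (h_diff x).
apply: (cvgr_to_le hd); near=> t.
have t0 : 0 < t by near: t; exact: nbhs_right_gt.
have t1 : t < 1 by near: t; exact: nbhs_right_lt.
have t01 : 0 < t < 1 by rewrite t0.
have := convex_fun x y t01.
have -> : t *: y + (1 - t) *: x = t *: (y - x) + x by vector_ring.
rewrite /= => le1; rewrite /GRing.scale/= ler_pdivrMl//; lra.
Unshelve. all: by end_near. Qed.

Lemma grad_monotone x y : 0 <= '[x - y, grad h x - grad h y].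
Proof.
have := grad_ineq x y; have := grad_ineq y x.
by rewrite !innerBl !innerBr; lra.
Qed.

End Gradient.

(** The lower limit is the supremum of the tail infima, so one of them is positive and serves as
    [c]. *)
Lemma limn_inf_gt0 {R : realType} (u : nat -> R) (M : R) :
  (forall n, 0 < u n <= M) -> 0 < limn_inf u ->
  exists2 c, 0 < c & \forall n \near \oo, c <= u n.
Proof.
move=> uM; have u0 n : 0 <= u n by case/andP: (uM n) => /ltW.
rewrite limn_infE; last first.
  exists M; split; first exact: num_real.
  move=> r Mr n _ /=; rewrite ger0_norm//; case/andP: (uM n) => _ unM.
  by rewrite (le_trans unM)// ltW.
have has_sup_infs : has_sup (range (infs u)).
  split; first by exists (infs u 0), 0%N.
  exists M => _ [n _ <-]; apply: (@le_trans _ _ (u n)); last by case/andP: (uM n).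
  apply: inf_lbound; last by exists n => /=.
  by exists 0 => _ [k _ <-].
move=> /(sup_gt has_sup_infs.1)[_ [n _ <-] un]; exists (infs u n) => //.
exists n => // k /= nk; apply: inf_lbound; last by exists k.
by exists 0 => _ [j _ <-].
Qed.

(** * The primal-dual space *)

Section HsumMaps.
Context {R : realType} {I : finType} {G : I -> hilbertType R}.

Definition hsum_map (T : forall i, {linear G i -> G i}) (x : hsum G) : hsum G :=
  fun i => T i (x i).

Lemma hsum_map_is_linear T : linear (hsum_map T).
Proof.
move=> a x y; apply: functional_extensionality_dep => i.
by rewrite /hsum_map [LHS]linearP.
Qed.

HB.instance Definition _ T :=
  GRing.isLinear.Build R (hsum G) (hsum G) *:%R (hsum_map T) (hsum_map_is_linear T).

(** Weak convergence is tested against vectors supported on the coordinate [i]. *)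
Lemma weak_cvg_coord (u : nat -> hsum G) (l : hsum G) i :
  weak_cvg u l -> weak_cvg (fun n => u n i) (l i).
Proof.
move=> ul y; pose e : hsum G := dfwith (fun j => 0 : G j) i y.
have eE (w : hsum G) : '[w, e] = '[w i, y].
  rewrite hsum_innerE (bigD1 i)//= big1 ?addr0; last first.
    by move=> j ji; rewrite /e dfwithout 1?eq_sym// inner0r.
  by rewrite /e dfwithin.
by rewrite -eE; under eq_cvg do rewrite -eE; exact: ul.
Qed.

Lemma bounded_series_hsum (u : nat -> hsum G) :
  (forall i, bounded_series (fun n => `|u n i|)) -> bounded_series (fun n => `|u n|).
Proof.
move=> ub; apply: bounded_series_le (bounded_series_sum ub) => n.
exact: hsum_norm_le.
Qed.

End HsumMaps.

Lemma big_option {R : realType} {I : finType} (F : option I -> R) :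
  \sum_o F o = F None + \sum_i F (Some i).
Proof.
rewrite (bigD1 None)//=; congr (_ + _).
rewrite (reindex_omap Some id)/=; last by case.
by apply: eq_bigl => i; rewrite eqxx.
Qed.

Section PrimalDualSpace.
Context {R : realType} {I : finType} (H : hilbertType R) (G : I -> hilbertType R).

(** [None] is the primal coordinate and [Some i] the i-th dual one, so a single product theorem
    treats them alike. *)
Definition pd_family (o : option I) : hilbertType R :=
  if o is Some i then G i else H.

Definition pd_space : hilbertType R := hsum pd_family.

Definition pd_pair (x : H) (v : forall i, G i) : pd_space :=
  fun o => match o with Some i => v i | None => x end.

Lemma pd_ext (w w' : pd_space) : w None = w' None ->
  (forall i, w (Some i) = w' (Some i)) -> w = w'.
Proof. by move=> w0 wi; apply: functional_extensionality_dep => -[i|]. Qed.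

Lemma pd_innerE (w w' : pd_space) :
  '[w, w'] = '[w None, w' None] + \sum_i '[w (Some i), w' (Some i)].
Proof. by rewrite hsum_innerE big_option. Qed.

Context (L : forall i, {linear H -> G i}).
Hypothesis L_bounded : forall i, bounded_op (L i).

Definition pd_skew (w : pd_space) : pd_space :=
  pd_pair (\sum_i adjoint (L i) (w (Some i))) (fun i => - L i (w None)).

Lemma adjointB i (u v : G i) : adjoint (L i) (u - v) = adjoint (L i) u - adjoint (L i) v.
Proof.
by apply: inner_ext => y; rewrite innerBl !(innerC _ y) -!adjointP// innerBr.
Qed.

Lemma pd_skewB w w' : pd_skew (w - w') = pd_skew w - pd_skew w'.
Proof.
apply: pd_ext => [|i].
  rewrite /pd_skew /pd_pair -[RHS]/(_ - _) -sumrB; apply: eq_bigr => i _.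
  exact: adjointB.
change (- L i (w None - w' None) = - L i (w None) - - L i (w' None)).
by rewrite linearB opprB opprK addrC.
Qed.

Lemma pd_skew_inner w : '[w, pd_skew w] = 0.
Proof.
rewrite pd_innerE; set x : H := w None; set v : forall i, G i := fun i => w (Some i).
change ('[x, \sum_i adjoint (L i) (v i)] + \sum_i '[v i, - L i x] = 0).
rewrite innerC inner_suml -big_split big1// => i _ /=.
by rewrite innerNr (innerC _ x) -adjointP// (innerC (v i)) subrr.
Qed.

Lemma pd_normE (w : pd_space) :
  `|w| ^+ 2 = `|w None| ^+ 2 + \sum_i `|w (Some i)| ^+ 2.
Proof. by rewrite hsum_normE big_option. Qed.

(** The map x -> (L_i x) has norm at most the square root, and its adjoint inherits the bound
    through Cauchy-Schwarz on [w1] and [w2]. The two blocks have orthogonal sources and targets, so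
    the constant is not enlarged. *)
Lemma pd_skew_norm w : `|pd_skew w| <= Num.sqrt (\sum_i opnorm (L i) ^+ 2) * `|w|.
Proof.
set s2 := \sum_i _.
have s0 : 0 <= s2 by apply: sumr_ge0 => i _; exact: sqr_ge0.
have L_sqr y : \sum_i `|L i y| ^+ 2 <= s2 * `|y| ^+ 2.
  rewrite /s2 mulr_suml; apply: ler_sum => i _.
  by rewrite -exprMn ler_pXn2r ?nnegrE ?mulr_ge0 ?opnorm_ge0// opnorm_le.
set a := \sum_i adjoint (L i) (w (Some i)).
have a_sqr : `|a| ^+ 2 <= s2 * \sum_i `|w (Some i)| ^+ 2.
  pose w1 := pd_pair 0 (fun i => w (Some i)).
  pose w2 := pd_pair 0 (fun i => L i a).
  have aE : '[a, a] = '[w1, w2].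
    rewrite pd_innerE /= inner0l add0r {1}/a inner_suml; apply: eq_bigr => i _.
    by rewrite innerC -adjointP// innerC.
  have w1E : `|w1| ^+ 2 = \sum_i `|w (Some i)| ^+ 2.
    by rewrite pd_normE /w1/= normr0 expr0n add0r.
  have w2E : `|w2| ^+ 2 <= s2 * `|a| ^+ 2.
    by rewrite pd_normE /w2/= normr0 expr0n add0r L_sqr.
  have := inner_sqr w1 w2; rewrite -aE !innerE -w1E.
  have [->|a0] := eqVneq `|a| 0; first by rewrite expr0n mulr_ge0 ?sqr_ge0.
  have ap : 0 < `|a| ^+ 2 by rewrite exprn_gt0// lt_def a0 normr_ge0.
  rewrite (expr2 (_ ^+ 2)) => h; rewrite -(ler_pM2r ap) (le_trans h)//.
  by have := ler_wpM2l (sqr_ge0 `|w1|) w2E; lra.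
rewrite -(@ler_pXn2r _ 2)// ?nnegrE ?mulr_ge0 ?sqrtr_ge0//.
rewrite [leRHS]exprMn (sqr_sqrtr s0) !pd_normE /= -/a mulrDr addrC lerD//.
by under eq_bigr do rewrite normrN.
Qed.

Section Forward.
Context (D : H -> H).

Definition pd_forward (w : pd_space) : pd_space :=
  pd_pair (D (w None)) (fun=> 0) + pd_skew w.

Lemma pd_forwardB w w' : pd_forward w - pd_forward w' =
  pd_pair (D (w None) - D (w' None)) (fun=> 0) + pd_skew (w - w').
Proof.
rewrite pd_skewB /pd_forward opprD addrACA; congr (_ + _).
by apply: pd_ext => // i; exact: subrr.
Qed.

Lemma pd_forward_monotone : (forall x y, 0 <= '[x - y, D x - D y]) ->
  forall w w', 0 <= '[w - w', pd_forward w - pd_forward w'].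
Proof.
move=> D_mono w w'; rewrite pd_forwardB innerDr pd_skew_inner addr0 pd_innerE.
rewrite big1 ?addr0; first exact: D_mono.
by move=> i _; exact: inner0r.
Qed.

Lemma pd_forward_lipschitz (k : R) : 0 <= k ->
  (forall x y, `|D x - D y| <= k * `|x - y|) ->
  forall w w', `|pd_forward w - pd_forward w'| <=
    (k + Num.sqrt (\sum_i opnorm (L i) ^+ 2)) * `|w - w'|.
Proof.
move=> k0 D_lip w w'; rewrite pd_forwardB mulrDl (le_trans (ler_normD _ _))//.
apply: lerD; last exact: pd_skew_norm.
apply: (@le_trans _ _ (k * `|w None - w' None|)); last first.
  by rewrite ler_wpM2l//; exact: (hsum_coord_le (w - w') None).
apply: le_trans (D_lip _ _).
rewrite -(@ler_pXn2r _ 2)// ?nnegrE// pd_normE big1 ?addr0// => i _.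
by rewrite /pd_pair normr0 expr0n.
Qed.

End Forward.

End PrimalDualSpace.

(** * Sufficiency of the optimality conditions *)

Section Optimality.
Context {R : realType} (H : hilbertType R) (z : H) (m : nat).
Context (G : 'I_m -> hilbertType R) (f : H -> \bar R) (h : H -> R^o).
Context (r : forall i, G i) (g : forall i, G i -> \bar R).
Context (L : forall i, {linear H -> G i}).
Arguments g : clear implicits.
Hypothesis f0 : Gamma0 f.
Hypothesis g0 : forall i, Gamma0 (g i).
Hypothesis h_convex : convex_function [set: convex_lmodType H] h.
Hypothesis h_diff : forall x, differentiable h x.
Hypothesis L_bounded : forall i, bounded_op (L i).
Context (xb u : H) (vb : forall i, G i).
Hypothesis fu : subdiff f xb u.
Hypothesis gv : forall i, subdiff (g i) (L i xb - r i) (vb i).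
Arguments g0 : clear implicits.
Arguments gv : clear implicits.
Hypothesis uE : u + \sum_i adjoint (L i) (vb i) + grad h xb = z.

Let fx := fine (f xb).
Let gx i := fine (g i (L i xb - r i)).

Let fxE : f xb = fx%:E.
Proof. exact: subdiff_fin f0 fu. Qed.

Let gxE i : g i (L i xb - r i) = (gx i)%:E.
Proof. exact: subdiff_fin (g0 i) (gv i). Qed.

(** The subgradient inequalities of all terms are added; by [uE] their linear parts cancel against
    z. *)
Lemma argmin_primal_obj : argmin (primal_obj z f h r g L) xb.
Proof.
move=> y; rewrite /primal_obj fxE.
under eq_bigr do rewrite gxE.
rewrite sumEFin -!EFinD.
apply: (@le_trans _ _ (('[y - xb, u] + fx) +
   \sum_i ('[L i (y - xb), vb i] + gx i) + h y - '[y, z])%:E).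
  rewrite lee_fin big_split/=.
  have -> : \sum_i '[L i (y - xb), vb i] = '[y - xb, \sum_i adjoint (L i) (vb i)].
    rewrite [RHS]innerC inner_suml; apply: eq_bigr => i _.
    by rewrite adjointP// innerC.
  have := grad_ineq h_convex h_diff xb y.
  rewrite -uE !innerBl !innerDr; lra.
rewrite EFinB leeD// !EFinD !leeD//.
  by rewrite -fxE; exact: fu.
rewrite -sumEFin lee_sum// => i _.
have := gv i (L i y - r i); rewrite gxE.
have -> : L i y - r i - (L i xb - r i) = L i (y - xb).
  by rewrite [RHS]linearB; vector_ring.
by rewrite EFinD.
Qed.

(** Both intermediate values equal minus the primal value at [xb]. Fenchel-Young inequalities at
    [xb] put it below the dual objective at every [v]; the subgradient conditions bound the
    objective at [vb] by it. *)
Lemma argmin_dual_obj : argmin (dual_obj z f h r g L) vb.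
Proof.
have hN x : (-oo < (h x)%:E)%E by exact: ltNyr.
have fN x : (-oo < f x)%E by case: f0.
have conjh : (conjugate (fun x => (h x)%:E) (grad h xb) <=
    ('[xb, grad h xb] - h xb)%:E)%E.
  apply/conjugate_leP => // y w [<-].
  by have := grad_ineq h_convex h_diff xb y; rewrite innerBl; lra.
have conj_ge (k : H -> \bar R) w s : k xb = s%:E -> (('[xb, w] - s)%:E <= conjugate k w)%E.
  by move=> ks; apply: ereal_sup_ubound; exists xb => //; rewrite ks.
move=> v; rewrite /dual_obj.
apply: (@le_trans _ _ ('[xb, z] - \sum_i '[L i xb, vb i] - fx - h xb
    + \sum_i ('[L i xb - r i, vb i] - gx i + '[vb i, r i]))%:E).
  rewrite [in leRHS]EFinD; apply: leeD; last first.
    rewrite -sumEFin lee_sum// => i _.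
    by rewrite (conjugate_subdiffE (g0 i) (gv i)) -EFinD.
  apply: (@le_trans _ _ (conjugate f u + conjugate (fun x => (h x)%:E) (grad h xb))%E).
    apply: ereal_inf_lbound; exists u => //; congr (_ + conjugate _ _)%E.
    by rewrite -uE; vector_ring.
  apply: (@le_trans _ _ (('[xb, u] - fx)%:E + ('[xb, grad h xb] - h xb)%:E)%E).
    by rewrite (conjugate_subdiffE f0 fu) leeD.
  rewrite -EFinD lee_fin -uE !innerDr (innerC xb (\sum_i _)) inner_suml.
  under [X in _ <= _ - X - _ - _]eq_bigr do rewrite adjointP// innerC.
  lra.
apply: (@le_trans _ _ ('[xb, z - \sum_i adjoint (L i) (v i)] - fx - h xb
    + \sum_i ('[L i xb - r i, v i] - gx i + '[v i, r i]))%:E).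
  rewrite lee_fin innerBr (innerC xb (\sum_i _)) inner_suml.
  have sumE (w : forall i, G i) :
    \sum_i ('[L i xb - r i, w i] - gx i + '[w i, r i]) =
    \sum_i '[L i xb, w i] - \sum_i gx i.
    rewrite -sumrB; apply: eq_bigr => i _.
    by rewrite innerBl (innerC (r i)); lra.
  rewrite !sumE.
  under [X in _ <= _ - X - _ - _ + _]eq_bigr do rewrite innerC -adjointP//.
  lra.
rewrite EFinD; apply: leeD.
  apply: le_ereal_inf_tmp => _ [y _ <-].
  apply: (@le_trans _ _ (('[xb, y] - fx)%:E +
      ('[xb, z - \sum_i adjoint (L i) (v i) - y] - h xb)%:E)%E).
    by rewrite -EFinD lee_fin !innerBr; lra.
  by rewrite leeD ?conj_ge.
rewrite -sumEFin lee_sum// => i _; rewrite EFinD leeD//.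
by apply: ereal_sup_ubound; exists (L i xb - r i) => //; rewrite gxE.
Qed.

End Optimality.

(** * Splitting for a translated product of subdifferentials *)

Section ProximalForwardBackwardForward.
Context {R : realType} {I : finType} {G : I -> hilbertType R}.
Context (phi : forall i, G i -> \bar R) (s : hsum G) (B : hsum G -> hsum G) (beta : R).
Arguments phi : clear implicits.
Hypothesis phi_Gamma0 : forall i, Gamma0 (phi i).
Arguments phi_Gamma0 : clear implicits.
Hypothesis beta_gt0 : 0 < beta.
Hypothesis B_monotone : forall x y, 0 <= '[x - y, B x - B y].
Hypothesis B_lipschitz : forall x y, `|B x - B y| <= beta * `|x - y|.

Context (alpha mu : R) (U : forall i, nat -> {linear G i -> G i}) (eta : I -> nat -> R).
Hypothesis alpha_gt0 : 0 < alpha.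
Hypothesis mu_gt0 : 0 < mu.
Hypothesis U_Pcal : forall i n, Pcal alpha (U i n).
Hypothesis U_le : forall i n, opnorm (U i n) <= mu.
Hypothesis eta_ge0 : forall i n, 0 <= eta i n.
Hypothesis eta_bs : forall i, bounded_series (eta i).
Hypothesis U_mono : forall i n,
  loewner_ge (fun x => (1 + eta i n) *: U i n.+1 x) (U i n).

Context (a b c : nat -> hsum G).
Hypothesis a_bs : bounded_series (fun n => `|a n|).
Hypothesis b_bs : bounded_series (fun n => `|b n|).
Hypothesis c_bs : bounded_series (fun n => `|c n|).

Context (lambda : R) (gamma : nat -> R).
Hypothesis lambda_le : (lambda * mu * beta) ^+ 2 <= 10^-1.
Hypothesis gamma_itv : forall n, 0 < gamma n <= lambda.
Hypothesis gamma_liminf : 0 < limn_inf gamma.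

Context (p_init : hsum G) (x y p q : nat -> hsum G).
Hypothesis yE : forall n i,
  y n i = x n i - gamma n *: U i n (B (lag p_init p n) i + a n i).
Hypothesis pE : forall n i, p n i =
  prox (opinv (U i n)) (fun w => (gamma n)%:E * phi i w)%E
    (y n i + gamma n *: U i n (s i)) + b n i.
Hypothesis qE : forall n i, q n i = p n i - gamma n *: U i n (B (p n) i + c n i).
Hypothesis xE : forall n i, x n.+1 i = x n i - y n i + q n i.

Let A (w u : hsum G) := forall i, subdiff (phi i) (w i) (u i + s i).

Theorem prox_fbf_cvg (z : hsum G) : A z (- B z) ->
  bounded_series (fun n => `|x n - p n| ^+ 2) /\
  exists l, [/\ A l (- B l), weak_cvg x l & weak_cvg p l].
Proof.
have gamma_gt0 n : 0 < gamma n by case/andP: (gamma_itv n).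
have [gamma0 gamma0_gt0 gamma_ge] := limn_inf_gt0 gamma_itv gamma_liminf.
pose W i n := sval (cid (opinv_linear alpha_gt0 (U_Pcal i n))).
have WE i n : W i n = opinv (U i n) :> (G i -> G i).
  by rewrite /W; case: cid.
have A_monotone w1 w2 u1 u2 : A w1 u1 -> A w2 u2 -> 0 <= '[w1 - w2, u1 - u2].
  move=> A1 A2; apply: sumr_ge0 => i _.
  have := subdiff_monotone (phi_Gamma0 i) (A1 i) (A2 i).
  by have -> : u1 i + s i - (u2 i + s i) = (u1 - u2) i by rewrite opprD addrACA subrr addr0.
have A_resolvent (t : R) w : 0 < t -> exists u, A u (t^-1 *: (w - u)).
  move=> t0.
  pose P i u := subdiff (phi i) u (t^-1 *: (w i - u) + s i).
  have Pex i : exists u, P i u.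
    (* A translation of the operator by [s] is a translation of the resolvent argument by
       [t *: s]. *)
    have [u hu] := resolvent_exists (w i + t *: s i) t0 (phi_Gamma0 i).
    exists u; rewrite /P.
    have -> : t^-1 *: (w i - u) + s i = t^-1 *: (w i + t *: s i - u) => //.
    have t1 : t != 0 by rewrite gt_eqF.
    by apply: inner_ext => v; rewrite !(innerDl, innerNl, innerZl); field; rewrite t1.
  by exists (fun i => sval (cid (Pex i))) => i; exact: svalP (cid (Pex i)).
have UK n : cancel (hsum_map (fun i => U i n)) (hsum_map (fun i => W i n)).
  move=> w; apply: functional_extensionality_dep => i.
  by rewrite /hsum_map WE (opinv_can alpha_gt0).
have W_sym n w u :
    '[hsum_map (fun i => W i n) w, u] = '[w, hsum_map (fun i => W i n) u].
  by apply: eq_bigr => i _; rewrite /hsum_map WE (opinv_sym alpha_gt0).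
have W_ge n (w : hsum G) : `|w| ^+ 2 <= mu * '[hsum_map (fun i => W i n) w, w].
  rewrite hsum_normE hsum_innerE mulr_sumr; apply: ler_sum => i _.
  by rewrite /hsum_map WE (opinv_ge alpha_gt0).
have W_le n (w : hsum G) :
    '[hsum_map (fun i => W i n) w, w] <= alpha^-1 * `|w| ^+ 2.
  rewrite hsum_normE hsum_innerE mulr_sumr; apply: ler_sum => i _.
  by rewrite /hsum_map WE (opinv_le alpha_gt0).
(* A single factor must serve the product metric; the sum dominates each [eta i] and remains
   summable. *)
pose etas n := \sum_i eta i n.
have etas_ge0 n : 0 <= etas n by exact: sumr_ge0.
have etas_bs : bounded_series etas by exact: bounded_series_sum.
have W_mono n (w : hsum G) : '[hsum_map (fun i => W i n.+1) w, w] <=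
    (1 + etas n) * '[hsum_map (fun i => W i n) w, w].
  rewrite !hsum_innerE mulr_sumr; apply: ler_sum => i _.
  rewrite /hsum_map !WE.
  apply: (@le_trans _ _ ((1 + eta i n) * '[opinv (U i n) (w i), w i])).
    by apply: (opinv_antitone alpha_gt0) => //; rewrite addr_ge0.
  rewrite ler_wpM2r//; last by rewrite lerD2l /etas (bigD1 i)//= lerDl sumr_ge0.
  have := opinv_ge alpha_gt0 (U_Pcal i n) (U_le i n) (w i).
  by rewrite -(pmulr_rge0 _ mu_gt0); apply: le_trans; exact: sqr_ge0.
have ptA n : A (p n - b n) ((gamma n)^-1 *: hsum_map (fun i => W i n) (y n - (p n - b n))).
  move=> i; set pt : G i := prox (opinv (U i n)) (fun w => (gamma n)%:E * phi i w)%E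
    (y n i + gamma n *: U i n (s i)).
  have ptE : (p n - b n) i = pt by rewrite -[LHS]/(p n i - b n i) pE addrK.
  rewrite ptE.
  have := prox_subdiff (y n i + gamma n *: U i n (s i)) alpha_gt0 (U_Pcal i n)
    (gamma_gt0 n) (phi_Gamma0 i).
  rewrite -/pt -WE => h.
  suff -> : ((gamma n)^-1 *: hsum_map (fun i => W i n) (y n - (p n - b n))) i + s i =
    (gamma n)^-1 *: W i n (y n i + gamma n *: U i n (s i) - pt) by [].
  rewrite -[X in X + _]/((gamma n)^-1 *: W i n (y n i - (p n - b n) i)) ptE.
  (* [W] undoes [U] on the shift of the prox argument, so division by [gamma n] leaves exactly
     [s i]. *)
  rewrite (addrAC (y n i)) [in RHS]linearD/= [W i n (_ *: _)]linearZ/= WE (opinv_can alpha_gt0)//.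
  have gn0 : gamma n != 0 by rewrite gt_eqF.
  by apply: inner_ext => v; rewrite !(innerDl, innerNl, innerZl); field; rewrite gn0.
apply: (@fbf_cvg _ _ _ _ _ A_monotone A_resolvent beta_gt0 B_monotone B_lipschitz
  _ _ _ _ _ alpha_gt0 mu_gt0 etas_ge0 etas_bs UK W_sym W_ge W_le W_mono
  _ _ _ a_bs b_bs c_bs _ _ lambda_le gamma_itv _ gamma0_gt0 gamma_ge p_init
  x y p q _ ptA) => n; apply: functional_extensionality_dep => i.
- exact: yE.
- exact: qE.
- exact: xE.
Qed.

End ProximalForwardBackwardForward.

Theorem theorem13 (R : realType) (H : hilbertType R) (z : H)
  (m : nat) (m_gt0 : (0 < m)%N)
  (f : H -> \bar R) (f_Gamma0 : Gamma0 f)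
  (h : H -> R^o)
  (h_convex : convex_function [set: convex_lmodType H] h)
  (h_diff : forall x, differentiable h x)
  (v0 : R) (v0_gt0 : 0 < v0) (gradh_lip : v0.-lipschitz (grad h))
  (G : 'I_m -> hilbertType R) (r : forall i, G i)
  (g : forall i, G i -> \bar R) (g_Gamma0 : forall i, Gamma0 (g i))
  (L : forall i, {linear H -> G i})
  (L_bounded : forall i, bounded_op (L i))
  (L_neq0 : forall i, exists x, L i x != 0)
  (z_ran : ran (fun x =>
     [set u + \sum_(i < m) adjoint (L i) (w i) + grad h x
       | u in subdiff f x
       & w in [set w : forall i, G i |
                forall i, subdiff (g i) (L i x - r i) (w i)]]) z)
  (alpha : R) (alpha_gt0 : 0 < alpha)
  (eta0 : nat -> R) (eta0_l1 : l1_plus eta0)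
  (U : nat -> {linear H -> H}) (U_Pcal : forall n, Pcal alpha (U n))
  (eta : 'I_m -> nat -> R) (eta_l1 : forall i, l1_plus (eta i))
  (UG : forall i, nat -> {linear G i -> G i})
  (UG_Pcal : forall i n, Pcal alpha (UG i n))
  (mu : R)
  (muE : ereal_sup (\bigcup_n ([set (opnorm (U n))%:E] `|`
           [set (opnorm (UG i n))%:E | i in [set: 'I_m]])) = mu%:E)
  (U_mono : forall n,
     loewner_ge (fun x => (1 + eta0 n) *: U n.+1 x) (U n))
  (UG_mono : forall n i,
     loewner_ge (fun y => (1 + eta i n) *: UG i n.+1 y) (UG i n))
  (a1 b1 c1 : nat -> H)
  (a1_sum : abs_summable a1) (b1_sum : abs_summable b1)
  (c1_sum : abs_summable c1)
  (a2 b2 c2 : forall i, nat -> G i)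
  (a2_sum : forall i, abs_summable (a2 i))
  (b2_sum : forall i, abs_summable (b2 i))
  (c2_sum : forall i, abs_summable (c2 i))
  (beta : R)
  (betaE : beta = v0 + Num.sqrt (\sum_(i < m) opnorm (L i) ^+ 2))
  (p1_init : H) (p2_init : forall i, G i)
  (lambda : R) (lambda_lt : lambda < 1 / (Num.sqrt 10 * mu * beta))
  (gamma : nat -> R) (gamma_itv : forall n, 0 < gamma n <= lambda)
  (gamma_liminf : 0 < limn_inf gamma)
  (x y1 p1 q1 : nat -> H) (v y2 p2 q2 : forall i, nat -> G i)
  (y1E : forall n, y1 n = x n - gamma n *:
     U n (grad h (lag p1_init p1 n)
          + \sum_(i < m) adjoint (L i) (lag (p2_init i) (p2 i) n) + a1 n))
  (y2E : forall n i, y2 i n = v i n + gamma n *: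
     UG i n (L i (lag p1_init p1 n) + a2 i n))
  (p2E : forall n i, p2 i n =
     prox (opinv (UG i n)) (fun w => (gamma n)%:E * conjugate (g i) w)%E
       (y2 i n - gamma n *: UG i n (r i)) + b2 i n)
  (p1E : forall n, p1 n =
     prox (opinv (U n)) (fun w => (gamma n)%:E * f w)%E
       (y1 n + gamma n *: U n z) + b1 n)
  (q2E : forall n i, q2 i n = p2 i n + gamma n *:
     UG i n (L i (p1 n) + c2 i n))
  (vE : forall n i, v i n.+1 = v i n - y2 i n + q2 i n)
  (q1E : forall n, q1 n = p1 n - gamma n *:
     U n (grad h (p1 n) + \sum_(i < m) adjoint (L i) (p2 i n) + c1 n))
  (xE : forall n, x n.+1 = x n - y1 n + q1 n) :
  ((\sum_(0 <= n <oo) (`|x n - p1 n| ^+ 2)%:E < +oo)%E /\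
   forall i, (\sum_(0 <= n <oo) (`|v i n - p2 i n| ^+ 2)%:E < +oo)%E) /\
  exists (xbar : H) (vbar : forall i, G i),
    [/\ argmin (primal_obj z f h r g L) xbar,
        argmin (dual_obj z f h r g L) vbar,
        [set u + grad h xbar | u in subdiff f xbar]
            (z - \sum_(j < m) adjoint (L j) (vbar j)) /\
          (forall i, subdiff (conjugate (g i)) (vbar i) (L i xbar - r i)),
        weak_cvg x xbar /\ weak_cvg p1 xbar &
        forall i, weak_cvg (v i) (vbar i) /\ weak_cvg (p2 i) (vbar i)].
Proof.
have sumE (a : nat -> R) : (forall n, 0 <= a n) ->
    (\sum_(0 <= n <oo) (a n)%:E < +oo)%E -> bounded_series a.
  by move=> a0 /(nneseries_ltyP a0).
have [xs [us fus [ws gws zE]]] := z_ran.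
have gs_conj i : subdiff (conjugate (g i)) (ws i) (L i xs - r i).
  by apply: subdiff_conjugate => //; exact: gws.
(* The range condition provides the point where the conjugate is finite. *)
have g_conj_Gamma0 i : Gamma0 (conjugate (g i)).
  apply: Gamma0_conjugate => //; exists (ws i).
  by rewrite (conjugate_subdiffE (g_Gamma0 i) (gws i)) ltry.
have U_le n : opnorm (U n) <= mu.
  rewrite -lee_fin -muE; apply: ereal_sup_ubound.
  by exists n => //; left.
have UG_le i n : opnorm (UG i n) <= mu.
  rewrite -lee_fin -muE; apply: ereal_sup_ubound.
  by exists n => //; right; exists i.
(* A nonzero [L i] yields a nonzero vector of [H], on which coercivity gives alpha <= opnorm (U 0)
   <= mu. *)
have mu_gt0 : 0 < mu.
  have [e Le] := L_neq0 (Ordinal m_gt0).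
  have e0 : 0 < `|e| ^+ 2.
    rewrite exprn_gt0// normr_gt0; apply: contra_neq Le => ->.
    by rewrite linear0.
  have [bU _ /(_ e)] := U_Pcal 0%N; rewrite innerZl innerE => Ue.
  rewrite (lt_le_trans alpha_gt0)// (le_trans _ (U_le 0%N))//.
  rewrite -(ler_pM2r e0) (le_trans Ue)// (le_trans (ler_norm _))//.
  by rewrite (le_trans (inner_le _ _))// expr2 mulrA ler_wpM2r// opnorm_le.
have beta_gt0 : 0 < beta by rewrite betaE ltr_wpDr ?sqrtr_ge0.
have lambda_le : (lambda * mu * beta) ^+ 2 <= 10^-1.
  have lambda_gt0 : 0 < lambda by case/andP: (gamma_itv 0%N) => /lt_le_trans /[apply].
  have s10 : 0 < Num.sqrt 10 :> R by rewrite sqrtr_gt0.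
  have : lambda * mu * beta <= (Num.sqrt 10)^-1.
    move: lambda_lt; rewrite ltr_pdivlMr ?mulr_gt0// => h1.
    by rewrite -[leRHS]mul1r ler_pdivlMr// (le_trans _ (ltW h1))// le_eqVlt;
      apply/orP; left; apply/eqP; ring.
  have -> : 10^-1 = (Num.sqrt 10)^-1 ^+ 2 :> R by rewrite exprVn sqr_sqrtr.
  by move=> h1; rewrite ler_pXn2r// nnegrE ?invr_ge0 ?sqrtr_ge0// ltW// !mulr_gt0.
pose pd := pd_pair (H := H) (G := G).
pose phi (o : option 'I_m) : pd_family H G o -> \bar R :=
  match o with Some i => conjugate (g i) | None => f end.
pose s := pd z (fun i => - r i).
pose UU (o : option 'I_m) : nat -> {linear pd_family H G o -> pd_family H G o} :=
  match o with Some i => UG i | None => U end.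
pose etas (o : option 'I_m) := match o with Some i => eta i | None => eta0 end.
have phi_Gamma0 o : Gamma0 (phi o) by case: o.
have B_monotone := pd_forward_monotone L_bounded (grad_monotone h_convex h_diff).
have B_lipschitz w w' : `|pd_forward L (grad h) w - pd_forward L (grad h) w'| <= beta * `|w - w'|.
  rewrite betaE; apply: (pd_forward_lipschitz L_bounded (ltW v0_gt0)) => u u'.
  by have := gradh_lip (u, u'); exact.
have family_bs (u : nat -> H) (w : forall i, nat -> G i) :
    abs_summable u -> (forall i, abs_summable (w i)) ->
    bounded_series (fun n => `|pd (u n) (fun i => w i n)|).
  move=> uS wS; apply: bounded_series_hsum => -[i|].
    exact: (sumE (fun n => `|w i n|) (fun=> normr_ge0 _) (wS i)).
  exact: (sumE (fun n => `|u n|) (fun=> normr_ge0 _) uS).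
(* The dual coordinates of [pd_forward] are - L_i x, so the errors [a2] and [c2] enter the product
   iteration negated. *)
have N_sum (w : forall i, nat -> G i) : (forall i, abs_summable (w i)) ->
    forall i, abs_summable (fun n => - w i n).
  by move=> wS i; rewrite /abs_summable; under eq_eseriesr do rewrite normrN; exact: wS.
pose X n := pd (x n) (fun i => v i n).
pose P n := pd (p1 n) (fun i => p2 i n).
have PE n : lag (pd p1_init p2_init) P n =
    pd (lag p1_init p1 n) (fun i => lag (p2_init i) (p2 i) n) by case: n.
have [] := @prox_fbf_cvg R _ _ phi s (pd_forward L (grad h)) beta
  phi_Gamma0 beta_gt0 B_monotone B_lipschitz
  alpha mu UU etas alpha_gt0 mu_gt0 _ _ _ _ _
  (fun n => pd (a1 n) (fun i => - a2 i n)) (fun n => pd (b1 n) (fun i => b2 i n))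
  (fun n => pd (c1 n) (fun i => - c2 i n))
  (family_bs _ _ a1_sum (N_sum _ a2_sum)) (family_bs _ _ b1_sum b2_sum)
  (family_bs _ _ c1_sum (N_sum _ c2_sum))
  lambda gamma lambda_le gamma_itv gamma_liminf
  (pd p1_init p2_init) X (fun n => pd (y1 n) (fun i => y2 i n)) P
  (fun n => pd (q1 n) (fun i => q2 i n)) _ _ _ _ (pd xs ws) _.
- by move=> [i|] n; [exact: UG_Pcal | exact: U_Pcal].
- by move=> [i|] n; [exact: UG_le | exact: U_le].
- by move=> [i|] n; [case: (eta_l1 i) => + _; exact | case: eta0_l1 => + _; exact].
- move=> [i|].
    by case: (eta_l1 i) => eta_ge0; exact: sumE.
  by case: eta0_l1 => eta0_ge0; exact: sumE.
- by move=> [i|] n; [exact: UG_mono | exact: U_mono].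
- move=> n [i|]; rewrite PE.
    change (y2 i n = v i n - gamma n *: UG i n (0 - L i (lag p1_init p1 n) - a2 i n)).
    by rewrite y2E sub0r -opprD [in RHS]linearN scalerN opprK.
  change (y1 n = x n - gamma n *: U n (grad h (lag p1_init p1 n)
     + \sum_(i < m) adjoint (L i) (lag (p2_init i) (p2 i) n) + a1 n)).
  exact: y1E.
- move=> n [i|].
    change (p2 i n = prox (opinv (UG i n)) (fun w => (gamma n)%:E * conjugate (g i) w)%E
       (y2 i n + gamma n *: UG i n (- r i)) + b2 i n).
    by rewrite linearN scalerN.
  exact: p1E.
- move=> n [i|].
    change (q2 i n = p2 i n - gamma n *: UG i n (0 - L i (p1 n) - c2 i n)).
    by rewrite q2E sub0r -opprD [in RHS]linearN scalerN opprK.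
  exact: q1E.
- by move=> n [i|]; [exact: vE | exact: xE].
- move=> [i|].
    change (subdiff (conjugate (g i)) (ws i) (- (0 - L i xs) - r i)).
    by rewrite sub0r opprK; exact: gs_conj.
  change (subdiff f xs (- (grad h xs + \sum_(i < m) adjoint (L i) (ws i)) + z)).
  by rewrite -zE -(addrA us) [us + _]addrC (addrC (grad h xs)) addKr.
move=> XP_bs [l [lA Xl Pl]].
split.
  split.
    apply/nneseries_ltyP => [n|]; first exact: sqr_ge0.
    apply: bounded_series_le XP_bs => n; rewrite ler_pXn2r ?nnegrE//.
    exact: (hsum_coord_le (X n - P n) None).
  move=> i; apply/nneseries_ltyP => [n|]; first exact: sqr_ge0.
  apply: bounded_series_le XP_bs => n; rewrite ler_pXn2r ?nnegrE//.
  exact: (hsum_coord_le (X n - P n) (Some i)).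
pose xb : H := l None; pose vb i : G i := l (Some i).
pose ub := z - \sum_(i < m) adjoint (L i) (vb i) - grad h xb.
have fub : subdiff f xb ub.
  have := lA None.
  change (subdiff f xb (- (grad h xb + \sum_(i < m) adjoint (L i) (vb i)) + z) -> subdiff f xb ub).
  by rewrite /ub addrC opprD addrA addrAC.
have gcb i : subdiff (conjugate (g i)) (vb i) (L i xb - r i).
  have := lA (Some i).
  change (subdiff (conjugate (g i)) (vb i) (- (0 - L i xb) - r i) ->
    subdiff (conjugate (g i)) (vb i) (L i xb - r i)).
  by rewrite sub0r opprK.
(* The zero is expressed with the conjugates, whereas the optimality lemmas take subgradients of the
   [g i]; Fenchel inversion passes from one to the other. *)
have gb i : subdiff (g i) (L i xb - r i) (vb i) by exact: subdiff_of_conjugate.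
have ubE : ub + \sum_(i < m) adjoint (L i) (vb i) + grad h xb = z.
  by rewrite /ub addrAC subrK subrK.
exists xb, vb; split.
- exact: (argmin_primal_obj f_Gamma0 g_Gamma0 h_convex h_diff L_bounded fub gb ubE).
- exact: (argmin_dual_obj f_Gamma0 g_Gamma0 h_convex h_diff L_bounded fub gb ubE).
- by split=> //; exists ub => //; rewrite subrK.
- by split; [exact: (weak_cvg_coord Xl (i := None)) | exact: (weak_cvg_coord Pl (i := None))].
- move=> i; split.
    exact: (weak_cvg_coord Xl (i := Some i)).
  exact: (weak_cvg_coord Pl (i := Some i)).
Qed.
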